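(* Let $\varphi\in Map(2^{[5]},\mathbb N)$ be an element of the image of $\pi\colon(\mathbb P^3)^5\to Map(2^{[5]},\mathbb N)$, and consider the ($GL_4$-stable) fibre $\pi^{-1}(\varphi)\subset(\mathbb P^3)^5$. (1) If $\varphi$ is not of type $(4)$, $(5)$, $(5,5)$, $(5,8)$ or $(5,10)$, then $\pi^{-1}(\varphi)$ is a single $GL_4$-orbit. (2) If $\varphi$ is of type $(4)$, $(5)$, $(5,5)$, $(5,8)$, or $(5,10)$, then $GL_4\backslash\pi^{-1}(\varphi)$ is in bijection with some open dense subset of $\mathbb P^1$, $\mathbb P^1\times\mathbb P^1$, $\mathbb P^1$, $\mathbb P^1$, or $\mathbb P^2$ respectively.
   Context: $\mathbb K$ is an algebraically closed field of characteristic $0$; $\mathbb P^{n-1}$ is the set of lines in $\mathbb K^n$; $[5]=\{1,2,3,4,5\}$; $\mathbb N=\{0,1,2,\dots\}$. $GL_4=GL_4(\mathbb K)$ acts diagonally on $(\mathbb P^3)^5$. $Map(2^{[5]},\mathbb N)$ is the set of maps from the power set of $[5]$ to $\mathbb N$, and $\pi$ sends $v=([v_i])_{i=1}^5$ to the map $\pi(v)\colon I\mapsto\dim\mathrm{Span}\{v_i\}_{i\in I}$. An $r$-face of $\varphi$ is an inclusion-maximal element of $\varphi^{-1}(r)$. The type (rank type) of $\varphi$ is the sequence $(A_1,A_2,A_3,\dots)$, where $A_r$ is the number of $r$-faces of $\varphi$; for $\varphi$ in the image of $\pi$ with $\varphi([5])=r_0$ the final part $(A_{r_0},A_{r_0+1},\dots)=(1,0,0,\dots)$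 is omitted. Thus type $(4)$ means $(4,1,0,\dots)$, $(5)$ means $(5,1,0,\dots)$, $(5,5)$ means $(5,5,1,0,\dots)$, $(5,8)$ means $(5,8,1,0,\dots)$ and $(5,10)$ means $(5,10,1,0,\dots)$. Open and dense refer to the Zariski topology. *)

(* Defs.v *)
From mathcomp Require Import all_boot all_order all_algebra.
From mathcomp Require Import boolp classical_sets functions cardinality.
From mathcomp Require Import mpoly.

Set Implicit Arguments.
Unset Strict Implicit.
Unset Printing Implicit Defensive.

Import GRing.Theory.

Local Open Scope ring_scope.

(* [proj K n] is the projective space P^(n-1) of lines in K^n. *)
Definition proj (K : fieldType) (n : nat) : Type :=
  {L : {vspace 'cV[K]_n} | \dim L == 1%N}.

Definition conf (K : fieldType) : Type := {ffun 'I_5 -> proj K 4}.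

(* The map pi. The span of representatives v_i, i in I, is the sum of the lines
   [v_i], i in I. *)
Definition rank_map (K : fieldType) (v : conf K) : {ffun {set 'I_5} -> nat} :=
  [ffun I : {set 'I_5} => \dim (\sum_(i in I) val (v i))%VS].

Definition fibre (K : fieldType) (phi : {ffun {set 'I_5} -> nat}) :
    set (conf K) :=
  (@rank_map K @^-1` [set phi])%classic.

Definition GL_orbit (K : fieldType) (v : conf K) : set (conf K) :=
  [set w : conf K | exists2 g : 'M[K]_4, g \in unitmx &
     forall i, val (w i) = (linfun (mulmx g) @: val (v i))%VS]%classic.

(* The quotient GL_4 \ pi^-1(phi), as the set of orbits of points of the
   fibre; each such orbit lies in the fibre by [fibre_GL_stable] below. *)
Definition fibre_orbits (K : fieldType) (phi : {ffun {set 'I_5} -> nat}) :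
    set (set (conf K)) :=
  (@GL_orbit K @` @fibre K phi)%classic.

(* The number A_r of r-faces. *)
Definition nb_faces (phi : {ffun {set 'I_5} -> nat}) (r : nat) : nat :=
  #|[pred I : {set 'I_5} | maxset (fun J => phi J == r) I]|.

(* [has_type phi [:: a_1; ..; a_k]] says that (A_1, A_2, ...) is the sequence
   (a_1, .., a_k, 1, 0, 0, ...). *)
Definition has_type (phi : {ffun {set 'I_5} -> nat}) (s : seq nat) : Prop :=
  forall r : nat, nb_faces phi r.+1 = nth 0%N (rcons s 1%N) r.

(* Zariski topologies, given by their closed sets. A homogeneous polynomial
   vanishes at a line iff it vanishes on all vectors of that line (for degree 0
   the value at the zero vector is the constant itself). *)

Definition zariski_closed (K : fieldType) (n : nat) (Z : set (proj K n)) :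
    Prop :=
  exists2 S : set {mpoly K[n]},
    forall p, S p -> exists d : nat, p \is d.-homog &
    Z = [set L : proj K n | forall p, S p ->
           forall x, x \in val L -> p.@[fun i => x i ord0] = 0]%classic.

(* Bihomogeneous of bidegree (d, e) in the first m and the last n variables. *)
Definition bihomog (K : fieldType) (m n d e : nat) (p : {mpoly K[m + n]}) :
    Prop :=
  forall u : 'X_{1.. m + n}, u \in msupp p ->
    (\sum_(i < m) u (lshift n i) = d)%N /\
    (\sum_(j < n) u (rshift m j) = e)%N.

(* The Zariski topology of a product of projective spaces, which is finer than
   the product of the Zariski topologies. *)
Definition zariski_closed_prod (K : fieldType) (m n : nat)
    (Z : set (proj K m * proj K n)) : Prop :=
  exists2 S : set {mpoly K[m + n]},
    forall p, S p -> exists d e : nat, bihomog d e p &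
    Z = [set LM : proj K m * proj K n | forall p, S p ->
           forall x y, x \in val LM.1 -> y \in val LM.2 ->
             p.@[fun i => col_mx x y i ord0] = 0]%classic.

(* [U] is open and dense for the topology whose closed sets are [closed]. *)
Definition open_dense (T : Type) (closed : set T -> Prop) (U : set T) : Prop :=
  closed (~` U)%classic /\
  forall O : set T, closed (~` O)%classic -> (O !=set0)%classic ->
    (O `&` U !=set0)%classic.

Lemma fibre_GL_stable (K : fieldType) (phi : {ffun {set 'I_5} -> nat})
    (v : conf K) :
  fibre phi v -> (GL_orbit v `<=` @fibre K phi)%classic.
Proof.
move=> <- w [g ug wE]; apply/ffunP => I; rewrite !ffunE.
under eq_bigr => i _ do rewrite wE.
rewrite -limg_sum limg_dim_eq //; apply/eqP.
suff -> : lker (linfun (mulmx g : 'cV[K]_4 -> 'cV[K]_4)) = 0%VS.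
  by rewrite capv0.
apply/eqP/lker0P => x y; rewrite !lfunE /= => /(congr1 (mulmx (invmx g))).
by rewrite !mulKmx.
Qed.

(* Main.v *)
Require Import Defs.
From mathcomp Require Import all_boot all_order all_algebra.
From mathcomp Require Import boolp classical_sets functions cardinality.
From mathcomp Require Import mpoly zify ring.

(** Choose a vector on each of the five lines and let A be the 5 x 4 matrix
whose rows are these vectors. Rescaling the vectors and moving them by GL_4
turns A into C A g with C diagonal invertible and g invertible, and the rank
map records the ranks of all subfamilies of rows of A. So the orbits in a
fibre are the classes of matrices of given row ranks under A ~ C A g
([GL_orbitP], [rank_map_spans]).

A matrix of rank r is determined up to the right action of GL_4 by its column
space, an r-dimensional subspace of K^5. Such a subspace is the column space of
a 5 x r matrix M, or the space orthogonal to the columns of a 5 x (5 - r)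
matrix M. In both cases M is unique up to GL_d on the right, the torus acts on
the rows of M, and the row ranks of A and of M determine each other: they agree
in the first case, and in the second the matroids are dual to each other, with
the rank formula [rank_dual]. This is Gale duality; it is packaged in
[encoding], with the two instances [primal_encoding] and [dual_encoding].

Since 1 <= r <= 4, one of r and 5 - r is at most 2, so M may be taken with d = 1
or d = 2 columns. For d = 1 (r = 1 or r = 4) the matroid of M is its support,
and two columns of the same support differ by the torus. For d = 2 (r = 2 or
r = 3) the rows of M are five vectors of K^2, and their matroid says which of
them vanish and which of them are parallel. The k classes of parallel nonzero
rows are k distinct points of P^1, and the torus lets one forget everything
else. Three points of P^1 can be moved to 1:0, 0:1 and 1:1, so the fibre is one
orbit if k <= 3; a fourth point s:1 and a fifth point t:1 then give the
invariants s for k = 4 and (s, t) for k = 5, where s and t avoid 0 and 1 and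
differ from each other ([to_normal_form], [normal_form_inj],
[fibre_two_rows]).

It remains to read k off the type. For r = 2, k is the number of distinct
points, so k = 4 and k = 5 are the types (4) and (5). For r = 3 the 2-faces are
the complements of the circuits of the dual matroid of rank 2, that is of its
loops, its parallel pairs and its triples of pairwise independent elements.
Counting them, k = 5 gives (5,10), k = 4 gives (5,5) or (5,8) according to
whether the fifth row of M vanishes or is parallel to another one, and k <= 3
gives none of these three types. As there are finitely many ways to distribute
five rows over the classes, both facts are established by evaluation
([all_checks]).

The parameter spaces are complements of curves or points in P^1, P^1 x P^1 and
P^2. The complement of the zero locus of a nonzero (bi)homogeneous polynomial
is open by definition, and dense because a product of two nonzero polynomials
over an infinite field has a nonzero value ([exists_nonzero_value]). *)

Set Implicit Arguments.
Unset Strict Implicit.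
Unset Printing Implicit Defensive.

Import GRing.Theory.

(** * Configurations as matrices with rescalable rows *)

Section Configurations.

Local Open Scope set_scope.
Local Open Scope ring_scope.

(** The statements speak of subspaces of K^n, the proofs of ranks of matrices. A row
base of B is a base of the span of the rows on both sides. *)
Lemma dim_span_rows (K : fieldType) (n m : nat) (B : 'M[K]_(n, m)) :
  \dim (\sum_(i < n) <[(row i B)^T]>)%VS = \rank B.
Proof.
pose b := [tuple (row j (row_base B))^T | j < \rank B].
have bE (j : 'I_(\rank B)) : b`_j = (row j (row_base B))^T.
  by rewrite -tnth_nth tnth_mktuple.
have trB (p : nat) (u : 'rV[K]_p) (C : 'M[K]_(p, m)) :
    (u *m C)^T = \sum_(i < p) u 0 i *: (row i C)^T.
  by rewrite mulmx_sum_row raddf_sum; apply: eq_bigr => i _ /=; rewrite linearZ.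
have fb : free b.
  apply/freeP => k; under eq_bigr => j _ do rewrite bE.
  have -> : \sum_(j < \rank B) k j *: (row j (row_base B))^T
      = ((\row_j k j) *m row_base B)^T.
    by rewrite trB; apply: eq_bigr => j _; rewrite mxE.
  move/(congr1 trmx); rewrite trmxK trmx0 => k0 j.
  have /row_freeP[C BC] := row_base_free B.
  have := congr1 (mulmx^~ C) k0.
  by rewrite -mulmxA BC mulmx1 mul0mx => /rowP/(_ j); rewrite !mxE.
suff -> : (\sum_(i < n) <[(row i B)^T]>)%VS = <<b>>%VS.
  by move: fb; rewrite /free => /eqP ->; rewrite size_tuple.
apply/eqP; rewrite eqEsubv; apply/andP; split.
  apply/subv_sumP => i _; rewrite -memvE.
  have /submxP[u ->] : (row i B <= row_base B)%MS
    by rewrite eq_row_base row_sub.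
  rewrite trB; apply: memv_suml => j _; apply: memvZ.
  by rewrite -bE memv_span // mem_nth // size_tuple.
apply/span_subvP => _ /mapP[j _ ->].
have /submxP[u ->] : (row j (row_base B) <= B)%MS.
  by rewrite -(eq_row_base B) row_sub.
rewrite trB; apply: memv_suml => i _; apply: memvZ.
by apply: subvP (memv_line _); rewrite (sumv_sup i).
Qed.

Definition spans {K : fieldType} (A : 'M[K]_(5, 4)) (v : conf K) : Prop :=
  forall i, val (v i) = <[(row i A)^T]>%VS.

(** The rows of [sel J *m M] are those of M with index in J, and zeros: this
expresses the rank of a subfamily of rows without changing the format of M. *)
Definition sel (K : fieldType) {n : nat} (J : {set 'I_n}) : 'M[K]_n :=
  diag_mx (\row_i (i \in J)%:R).

Lemma row_sel (K : fieldType) (n m : nat) (J : {set 'I_n}) (M : 'M[K]_(n, m)) i :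
  row i (sel K J *m M) = (i \in J)%:R *: row i M.
Proof. by rewrite row_mul row_diag_mx -scalemxAl -rowE mxE. Qed.

Lemma rank_map_spans (K : fieldType) (A : 'M[K]_(5, 4)) (v : conf K) I :
  spans A v -> rank_map v I = \rank (sel K I *m A).
Proof.
move=> Av; rewrite ffunE -dim_span_rows big_mkcond; congr (\dim _).
apply: eq_bigr => i _; rewrite row_sel linearZ /= Av.
by case: (i \in I); rewrite ?scale1r ?scale0r //=.
Qed.

Lemma selT (K : fieldType) (n : nat) : sel K [set: 'I_n] = 1%:M.
Proof.
apply/matrixP => i j; rewrite !mxE inE.
by case: eqP => // ->.
Qed.

Lemma rank_map_setT (K : fieldType) (A : 'M[K]_(5, 4)) (v : conf K) :
  spans A v -> rank_map v [set: 'I_5] = \rank A.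
Proof. by move/rank_map_spans->; rewrite selT mul1mx. Qed.

Lemma line_gen (K : fieldType) (n : nat) (L : proj K n) :
  {x : 'cV[K]_n | x != 0 & val L = <[x]>%VS}.
Proof.
case: L => L /= /eqP dL; exists (vpick L).
  by rewrite vpick0 -dimv_eq0 dL.
apply/eqP; rewrite eq_sym eqEdim -memvE memv_pick /= dL dim_vline vpick0.
by rewrite -dimv_eq0 dL.
Qed.

Definition line_of {K : fieldType} {n : nat} (x : 'cV[K]_n) (x0 : x != 0) :
    proj K n :=
  exist _ <[x]>%VS (introT eqP (etrans (dim_vline x) (congr1 nat_of_bool x0))).

Lemma exists_spans (K : fieldType) (v : conf K) :
  exists A : 'M[K]_(5, 4), spans A v.
Proof.
exists (\matrix_i (s2val (line_gen (v i)))^T) => i.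
by rewrite rowK trmxK; case: (line_gen (v i)).
Qed.

Lemma spans_exists (K : fieldType) (A : 'M[K]_(5, 4)) :
  (forall i, \rank (sel K [set i] *m A) = 1%N) -> exists v, spans A v.
Proof.
move=> A1.
have A0 i : (row i A)^T != 0.
  apply/eqP => /(congr1 trmx); rewrite trmxK trmx0 => Ai0.
  suff : sel K [set i] *m A = 0 by move/(congr1 mxrank); rewrite A1 mxrank0.
  apply/row_matrixP => j; rewrite row_sel row0 inE.
  by case: eqP => [->|]; rewrite ?Ai0 ?scaler0 ?scale0r.
by exists [ffun i => line_of (A0 i)] => i; rewrite ffunE.
Qed.

Definition unit_diag {K : fieldType} {n : nat} (c : 'rV[K]_n) : Prop :=
  forall i, c 0 i != 0.

Definition inv_diag {K : fieldType} {n : nat} (c : 'rV[K]_n) : 'rV[K]_n :=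
  \row_i (c 0 i)^-1.

Lemma unit_inv_diag (K : fieldType) n (c : 'rV[K]_n) :
  unit_diag c -> unit_diag (inv_diag c).
Proof. by move=> uc i; rewrite mxE invr_eq0. Qed.

Lemma mulVdiag (K : fieldType) n (c : 'rV[K]_n) :
  unit_diag c -> diag_mx (inv_diag c) *m diag_mx c = 1%:M.
Proof.
move=> uc; rewrite mulmx_diag; apply/matrixP => i j; rewrite !mxE.
by case: eqP => // ->; rewrite mulVf.
Qed.

Lemma mulKdiag (K : fieldType) n m (c : 'rV[K]_n) (A B : 'M[K]_(n, m)) :
  unit_diag c -> diag_mx c *m A = B -> A = diag_mx (inv_diag c) *m B.
Proof. by move=> uc <-; rewrite mulmxA mulVdiag // mul1mx. Qed.

Lemma rank_diag_mul (K : fieldType) n m (c : 'rV[K]_n) (A : 'M[K]_(n, m)) :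
  unit_diag c -> \rank (diag_mx c *m A) = \rank A.
Proof.
move=> uc; rewrite eqmxMfull // row_full_unit.
by have [] := mulmx1_unit (mulVdiag uc).
Qed.

(** An invertible g moves the lines of v to those of v' exactly when it moves the
chosen vectors to multiples of the chosen ones; the factors form the diagonal
matrix. The matrices of [GL_orbit] act on columns, hence the transposes. *)
Lemma GL_orbitP (K : fieldType) (A A' : 'M[K]_(5, 4)) (v v' : conf K) :
  spans A v -> spans A' v' ->
  GL_orbit v v' <->
  exists c, unit_diag c /\
    exists2 g, g \in unitmx & A' = diag_mx c *m A *m g.
Proof.
move=> Av Av'; split.
  case=> g ug vE.
  have cP i : exists c, c != 0 /\ row i A' = c *: (row i A *m g^T).
    have L : <[(row i A')^T]>%VS = <[g *m (row i A)^T]>%VS.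
      by rewrite -Av' vE Av limg_line lfunE.
    have := memv_line (row i A')^T; rewrite L => /vlineP[c cE]; exists c.
    have rE : row i A' = c *: (row i A *m g^T).
      by apply: trmx_inj; rewrite cE linearZ /= trmx_mul trmxK.
    split=> //; apply/eqP => c0.
    have := svalP (v' i); rewrite -[sval _]/(val (v' i)) Av'.
    by rewrite cE c0 scale0r dim_vline eqxx.
  have [c cE] := choice cP.
  exists (\row_i c i); split; first by move=> i; rewrite mxE; case: (cE i).
  exists g^T; first by rewrite unitmx_tr.
  apply/row_matrixP => i; rewrite (cE i).2 -mulmxA row_mul row_diag_mx.
  by rewrite -scalemxAl -rowE mxE row_mul.
case=> c [uc [g ug AE]]; exists g^T; first by rewrite unitmx_tr.
move=> i; rewrite Av' Av limg_line lfunE /=.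
have -> : (row i A')^T = c 0 i *: (g^T *m (row i A)^T).
  rewrite AE -mulmxA row_mul row_diag_mx -scalemxAl -rowE row_mul linearZ /=.
  by rewrite trmx_mul.
apply/eqP; rewrite eqEsubv -!memvE memvZ ?memv_line //=.
have {1}-> : g^T *m (row i A)^T
    = (c 0 i)^-1 *: (c 0 i *: (g^T *m (row i A)^T)).
  by rewrite scalerA mulVf ?scale1r.
by rewrite memvZ ?memv_line.
Qed.

End Configurations.

(** * Encoding by the column space and by its orthogonal *)

Section Encodings.

Local Open Scope set_scope.
Local Open Scope ring_scope.

(** The orbit relation under the torus of diagonal matrices on the left and GL_d
on the right. For d = 4 it is the relation between configurations found in
[GL_orbitP], for smaller d the one between the matrices that encode them. *)
Definition torus_equiv {K : fieldType} {n d : nat} (M M' : 'M[K]_(n, d)) : Prop :=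
  exists c, unit_diag c /\
    exists2 h, h \in unitmx & M' = diag_mx c *m M *m h.

Lemma sel_setC_add (K : fieldType) (n : nat) (J : {set 'I_n}) :
  sel K J + sel K (~: J) = 1%:M.
Proof.
rewrite -selT /sel -linearD /=; congr diag_mx; apply/rowP => i.
by rewrite !mxE !inE; case: (i \in J); rewrite ?addr0 ?add0r.
Qed.

Lemma sel_setC_mul (K : fieldType) (n : nat) (J : {set 'I_n}) :
  sel K J *m sel K (~: J) = 0.
Proof.
rewrite /sel mulmx_diag; apply/matrixP => i j; rewrite !mxE !inE.
by case: (i \in J); rewrite /= ?mulr0 ?mul0r mul0rn.
Qed.

(** The rank is at most the number of nonzero rows, for J as well as for its
complement. As the two projections add up to the identity, both bounds are
attained. *)
Lemma rank_sel (K : fieldType) (n : nat) (J : {set 'I_n}) :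
  \rank (sel K J) = #|J|.
Proof.
have le (I : {set 'I_n}) : (\rank (sel K I) <= #|I|)%N.
  apply: leq_trans (rank_leq_row (rowsub (@enum_val _ (mem I)) (sel K I))).
  apply/mxrankS/row_subP => i.
  have [iI|iI] := boolP (i \in I); last first.
    by rewrite -[sel K I]mulmx1 row_sel (negPf iI) scale0r sub0mx.
  rewrite -[i in row i _](enum_rankK_in iI iI) -row_rowsub.
  exact: row_sub.
have := mxrank_add (sel K J) (sel K (~: J)).
rewrite sel_setC_add mxrank1; have := cardsC J; rewrite card_ord.
move: (le J) (le (~: J)) => l1 l2 En h; apply/eqP; rewrite eqn_leq l1 /=.
by rewrite -(leq_add2r #|~: J|) En (leq_trans h) // leq_add2l.
Qed.

Lemma kermx_sel (K : fieldType) (n : nat) (J : {set 'I_n}) :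
  (kermx (sel K (~: J)) :=: sel K J)%MS.
Proof.
apply/eqmxP/andP; split; last exact/sub_kermxP/sel_setC_mul.
set k := kermx _.
have k0 : k *m sel K (~: J) = 0 by apply: mulmx_ker.
rewrite -[X in (X <= _)%MS]mulmx1 -(sel_setC_add K J) mulmxDr k0 addr0.
exact: submxMl.
Qed.

Lemma kermx_dual (K : fieldType) (n d m : nat) (M : 'M[K]_(n, d))
    (A : 'M[K]_(n, m)) :
  M^T *m A = 0 -> (\rank M + \rank A = n)%N -> (kermx A :=: M^T)%MS.
Proof.
move=> MA0 rMA.
have lMA : (M^T <= kermx A)%MS by apply/sub_kermxP.
apply/eqmx_sym/eqmxP; rewrite -(mxrank_leqif_eq lMA).
by rewrite mxrank_tr mxrank_ker; apply/eqP/esym; move: rMA; lia.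
Qed.

(** The rank formula of matroid duality. The number of elements of I minus the rank
of A on I and the rank of M minus its rank outside I are both the dimension of
the space of relations between the rows of A with support in I. *)
Lemma rank_dual (K : fieldType) (n d m : nat) (M : 'M[K]_(n, d))
    (A : 'M[K]_(n, m)) (I : {set 'I_n}) :
  M^T *m A = 0 -> (\rank M + \rank A = n)%N ->
  (\rank (sel K I *m A) + \rank M = #|I| + \rank (sel K (~: I) *m M))%N.
Proof.
move=> MA0 rMA.
have kA := kermx_dual MA0 rMA.
have e1 := mxrank_mul_ker (sel K I) A.
have e2 := mxrank_mul_ker M^T (sel K (~: I)).
rewrite mxrank_tr (cap_eqmx (eqmx_refl _) (kermx_sel K I)) in e2.
rewrite rank_sel (cap_eqmx (eqmx_refl _) kA) capmxC in e1.
have -> : \rank (sel K (~: I) *m M) = \rank (M^T *m sel K (~: I)).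
  by rewrite -mxrank_tr trmx_mul [(sel _ _)^T]tr_diag_mx.
by rewrite -e1 -e2 addnA addnAC.
Qed.

(** The column space of A is the space orthogonal to the relations between its rows,
so it contains the columns of any A' whose rows satisfy the same relations. *)
Lemma kermx_sub_factor (K : fieldType) (n m p : nat) (A : 'M[K]_(n, m))
    (A' : 'M[K]_(n, p)) :
  kermx A *m A' = 0 -> exists f, A' = A *m f.
Proof.
move=> kA'.
(* The columns of the cokernel of A^T are, transposed, relations between the rows
   of A. *)
have /submxP[f fE] : (A'^T <= A^T)%MS.
  rewrite submxE.
  have /submxP[u uE] : ((cokermx A^T)^T <= kermx A)%MS.
    by apply/sub_kermxP/trmx_inj; rewrite trmx_mul trmxK mulmx_coker trmx0.
  by rewrite -trmx_eq0 trmx_mul trmxK uE -mulmxA kA' mulmx0.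
by exists f^T; apply: trmx_inj; rewrite trmx_mul trmxK.
Qed.

(** Serves to see from the rank of the image alone that a change of coordinates
obtained by solving linear equations is invertible. *)
Lemma unit_of_rank (K : fieldType) (n d : nat) (M : 'M[K]_(n, d)) (h : 'M_d) :
  \rank (M *m h) = d -> h \in unitmx.
Proof.
move=> r; rewrite -row_full_unit /row_full eqn_leq rank_leq_col /=.
by rewrite -[X in (X <= _)%N]r mxrankM_maxr.
Qed.

(** M is a base of the column space of a matrix of vectors of v; B holds the
coordinates of its four columns in that base. *)
Definition primal_code {K : fieldType} (d : nat) (M : 'M[K]_(5, d))
    (v : conf K) : Prop :=
  \rank M = d /\ exists A, spans A v /\
    exists2 B : 'M_(d, 4), row_free B & A = M *m B.

(** The columns of M form a base of the linear relations between vectors of v. *)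
Definition dual_code {K : fieldType} (d : nat) (M : 'M[K]_(5, d))
    (v : conf K) : Prop :=
  \rank M = d /\ exists A,
    [/\ spans A v, M^T *m A = 0 & (\rank M + \rank A = 5)%N].

(** Equal column spaces, up to the torus, on both sides. A column operation that
carries A to A' need not be invertible at first, but can be replaced by an
invertible one because it preserves the rank. *)
Lemma primal_code_orbit (K : fieldType) (d : nat) (M M' : 'M[K]_(5, d))
    (v v' : conf K) :
  primal_code M v -> primal_code M' v' -> GL_orbit v v' <-> torus_equiv M M'.
Proof.
case=> rM [A [Av [B fB AE]]] [rM' [A' [Av' [B' fB' AE']]]].
rewrite (GL_orbitP Av Av'); split=> -[c [uc [g ug E]]]; exists c; split=> //.
  have ME : diag_mx c *m M *m (B *m g *m pinvmx B') = M'.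
    rewrite -[RHS](mulmxKp fB') -AE' E AE.
    by move: (pinvmx B') => P; rewrite !mulmxA.
  exists (B *m g *m pinvmx B') => //.
  by apply: (@unit_of_rank _ _ _ (diag_mx c *m M)); rewrite ME.
have rA : \rank A = d by rewrite AE mxrankMfree.
have AfE : A *m (pinvmx B *m g *m B') = M *m g *m B'.
  have := mulmxKp fB M; rewrite AE; move: (pinvmx B) => P MP.
  by rewrite !mulmxA MP.
have [|f uf fE] := @complete_unitmx _ _ _ A (pinvmx B *m g *m B').
  rewrite AfE mxrankMfree // rA -[RHS]rM' E -mulmxA rank_diag_mul //.
exists f => //; by rewrite -mulmxA -fE AfE AE' E !mulmxA.
Qed.

(** The same argument with relations: scaling the vectors by c scales the
coefficients of the relations by the inverse of c. *)
Lemma dual_code_orbit (K : fieldType) (d : nat) (M M' : 'M[K]_(5, d))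
    (v v' : conf K) :
  dual_code M v -> dual_code M' v' -> GL_orbit v v' <-> torus_equiv M M'.
Proof.
case=> rM [A [Av MA0 rA]] [rM' [A' [Av' MA0' rA']]].
have kA := kermx_dual MA0 rA; have kA' := kermx_dual MA0' rA'.
rewrite (GL_orbitP Av Av'); split=> -[c [uc [g ug E]]].
  have /submxP[k kE] : ((diag_mx c *m M')^T <= M^T)%MS.
    rewrite -kA; apply/sub_kermxP; rewrite trmx_mul tr_diag_mx -mulmxA.
    have : M'^T *m A' *m invmx g = 0 by rewrite MA0' mul0mx.
    by rewrite E !mulmxA mulmxK.
  have cM' : diag_mx c *m M' = M *m k^T.
    by apply: trmx_inj; rewrite kE trmx_mul trmxK.
  exists (inv_diag c); split; first exact: unit_inv_diag.
  exists k^T.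
    apply: (@unit_of_rank _ _ _ M); rewrite -cM' rank_diag_mul //.
  by rewrite -mulmxA; apply: mulKdiag.
have [f fE] : exists f, diag_mx c *m A' = A *m f.
  apply: kermx_sub_factor.
  have /submxP[k ->] : (kermx A <= M^T)%MS by rewrite kA.
  have : M'^T *m A' = 0 by [].
  rewrite E !trmx_mul tr_diag_mx -!mulmxA => /(congr1 (mulmx (invmx g^T))).
  by rewrite mulKmx ?unitmx_tr // mulmx0 => ->; rewrite mulmx0.
have [|h uh hE] := @complete_unitmx _ _ _ A f.
  rewrite -fE rank_diag_mul //; apply/eqP.
  by rewrite -(eqn_add2l d) -{1}rM' rA' -{1}rM rA.
exists (inv_diag c); split; first exact: unit_inv_diag.
by exists h => //; rewrite -mulmxA -hE; apply: mulKdiag.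
Qed.

Lemma primal_code_rank (K : fieldType) (d : nat) (M : 'M[K]_(5, d)) v J :
  primal_code M v -> rank_map v J = \rank (sel K J *m M).
Proof.
case=> _ [A [Av [B fB AE]]].
by rewrite (rank_map_spans _ Av) AE mulmxA (mxrankMfree _ fB).
Qed.

Lemma dual_code_rank (K : fieldType) (d : nat) (M : 'M[K]_(5, d)) v J :
  dual_code M v -> (rank_map v J + d = #|J| + \rank (sel K (~: J) *m M))%N.
Proof.
case=> rM [A [Av MA0 rA]].
by have := rank_dual J MA0 rA; rewrite rM -(rank_map_spans _ Av).
Qed.

(** The properties by which a way of encoding configurations by 5 x d matrices
transfers the orbits in a fibre to the classes of [torus_equiv]. Both
[primal_code] and [dual_code] have them. *)
Definition encoding {K : fieldType} (phi : {ffun {set 'I_5} -> nat}) (d : nat)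
    (code : 'M[K]_(5, d) -> conf K -> Prop) (rho : {set 'I_5} -> nat) : Prop :=
  [/\ forall v, fibre phi v -> exists M, code M v,
      forall M, (forall J, \rank (sel K J *m M) = rho J) -> exists v, code M v,
      forall M v, code M v ->
        rank_map v = phi <-> forall J, \rank (sel K J *m M) = rho J
    & forall M M' v v', code M v -> code M' v' ->
        GL_orbit v v' <-> torus_equiv M M'].

Lemma rank_map1 (K : fieldType) (v : conf K) i : rank_map v [set i] = 1%N.
Proof. by rewrite ffunE big_set1; exact: eqP (svalP (v i)). Qed.

(** A matrix M with the row ranks prescribed by phi becomes a configuration of
lines by adding zero columns: no row vanishes since the rank map of v0 takes the
value 1 at singletons. *)
Lemma primal_encoding (K : fieldType) (v0 : conf K) :
  let phi := rank_map v0 in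
  encoding phi (@primal_code K (phi [set: 'I_5])) phi.
Proof.
move=> phi.
have d4 : (phi [set: 'I_5] <= 4)%N.
  have [A0 Av0] := exists_spans v0.
  by rewrite /phi (rank_map_setT Av0) rank_leq_col.
split.
- move=> v fv; have [A Av] := exists_spans v.
  have : \rank A = phi [set: 'I_5] by rewrite -(rank_map_setT Av) fv.
  move: (phi _) => d dE.
  suff [M [rM [B [fB AE]]]] : exists M : 'M[K]_(5, d), \rank M = d /\
      exists B : 'M_(d, 4), row_free B /\ A = M *m B.
    by exists M; split=> //; exists A; split=> //; exists B.
  rewrite -dE; exists (col_base A); split.
    by apply/eqP; have := col_base_full A; rewrite /row_full.
  by exists (row_base A); rewrite row_base_free mulmx_base.
- move=> M Mphi.
  have rM : \rank M = phi [set: 'I_5]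
    by have := Mphi [set: 'I_5]; rewrite selT mul1mx.
  have fB : row_free (pid_mx (phi [set: 'I_5]) : 'M[K]_(phi [set: 'I_5], 4)).
    by rewrite /row_free rank_pid_mx.
  have [|v Av] := @spans_exists K (M *m pid_mx (phi [set: 'I_5])).
    by move=> i; rewrite mulmxA mxrankMfree // Mphi /phi rank_map1.
  exists v; split=> //; exists (M *m pid_mx (phi [set: 'I_5])); split=> //.
  by exists (pid_mx (phi [set: 'I_5])).
- move=> M v Mv; split=> [/ffunP fv J|].
    by rewrite -(primal_code_rank J Mv) fv.
  by move=> Mphi; apply/ffunP => J; rewrite (primal_code_rank _ Mv).
- by move=> M M' v v'; apply: primal_code_orbit.
Qed.

(** A matrix M with the prescribed row ranks is the code of any family of vectors
whose relations are spanned by the columns of M. Such vectors are read off a base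
of the left kernel of M, which fits in K^4 by the bound on the rank. The
subtraction in the rank function is exact because the rank formula holds for
v0. *)
Lemma dual_encoding (K : fieldType) (v0 : conf K) :
  let phi := rank_map v0 in let d := (5 - phi [set: 'I_5])%N in
  encoding phi (@dual_code K d) (fun J => (d + phi (~: J)) - #|~: J|)%N.
Proof.
move=> phi d.
have d4 : (phi [set: 'I_5] <= 4)%N.
  have [A0 Av0] := exists_spans v0.
  by rewrite /phi (rank_map_setT Av0) rank_leq_col.
have code_exists (v : conf K) :
    fibre phi v -> exists M : 'M_(5, d), dual_code M v.
  move=> fv; have [A Av] := exists_spans v.
  have dE : \rank (kermx A) = d.
    by rewrite mxrank_ker -(rank_map_setT Av) fv.
  suff [M [rM MA0]] : exists M : 'M[K]_(5, d), \rank M = d /\ M^T *m A = 0.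
    exists M; split=> //; exists A; split=> //.
    by rewrite rM -dE mxrank_ker subnK // rank_leq_row.
  rewrite -dE; exists (row_base (kermx A))^T; rewrite mxrank_tr trmxK.
  rewrite eq_row_base; split=> //.
  by apply/sub_kermxP; rewrite eq_row_base.
have card_le (J : {set 'I_5}) : (#|J| <= d + phi J)%N.
  have [|M0 M0v0] := code_exists v0; first by [].
  by have := dual_code_rank J M0v0; rewrite -/phi; lia.
split=> //.
- move=> M Mrho.
  have rM : \rank M = d.
    have := Mrho [set: 'I_5]; rewrite selT mul1mx finset.setCT.
    have -> : phi finset.set0 = 0%N by rewrite /phi ffunE big_set0 dimv0.
    by rewrite cards0 addn0 subn0.
  have kd : \rank (kermx M) = phi [set: 'I_5].
    by rewrite mxrank_ker rM /d subKn // ltnW.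
  pose A := (row_base (kermx M))^T *m
    (pid_mx (\rank (kermx M)) : 'M_(_, 4)).
  have rA : \rank A = \rank (kermx M).
    by rewrite mxrankMfree ?mxrank_tr ?eq_row_base // /row_free rank_pid_mx ?kd.
  have MA0 : M^T *m A = 0.
    rewrite mulmxA -trmx_mul.
    suff -> : row_base (kermx M) *m M = 0 by rewrite trmx0 mul0mx.
    by apply/sub_kermxP; rewrite eq_row_base.
  have rMA : (\rank M + \rank A = 5)%N.
    by rewrite rA mxrank_ker subnKC // rank_leq_row.
  have [|v Av] := @spans_exists K A.
    move=> i; have := rank_dual [set i] MA0 rMA; rewrite Mrho rM finset.setCK.
    have := card_le [set i]; rewrite {1 2}/phi rank_map1 cards1; lia.
  by exists v; split=> //; exists A; split.
- move=> M v Mv; split.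
    move=> fv J; have := dual_code_rank (~: J) Mv; rewrite fv finset.setCK; lia.
  move=> Mrho; apply/ffunP => J; have := dual_code_rank J Mv.
  by rewrite Mrho finset.setCK subnKC ?card_le // addnC => /addnI.
- by move=> M M' v v'; apply: dual_code_orbit.
Qed.

End Encodings.

(** * The matroid of five vectors of a plane *)

Section Patterns.

Local Open Scope set_scope.
Local Open Scope ring_scope.

Lemma torus_equiv_sym (K : fieldType) n d (M M' : 'M[K]_(n, d)) :
  torus_equiv M M' -> torus_equiv M' M.
Proof.
case=> c [uc [h uh ->]]; exists (inv_diag c); split; first exact: unit_inv_diag.
exists (invmx h); first by rewrite unitmx_inv.
by rewrite -!mulmxA mulmxV // mulmx1 mulmxA mulVdiag // mul1mx.
Qed.

Lemma torus_equiv_trans (K : fieldType) n d (M1 M2 M3 : 'M[K]_(n, d)) :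
  torus_equiv M1 M2 -> torus_equiv M2 M3 -> torus_equiv M1 M3.
Proof.
case=> c [uc [h uh ->]] [c' [uc' [h' uh' ->]]].
exists (\row_i (c' 0 i * c 0 i)); split.
  by move=> i; rewrite mxE mulf_neq0.
exists (h *m h'); first by rewrite unitmx_mul uh.
by rewrite -mulmx_diag !mulmxA.
Qed.

Lemma torus_equiv_row_eq0 (K : fieldType) n d (M M' : 'M[K]_(n, d)) i :
  torus_equiv M M' -> (row i M' == 0) = (row i M == 0).
Proof.
case=> c [uc [h uh ->]].
rewrite -mulmxA row_mul row_diag_mx -scalemxAl -rowE scaler_eq0.
rewrite (negPf (uc i)) /= row_mul.
apply/eqP/eqP => [/(congr1 (mulmx^~ (invmx h)))|->].
  by rewrite mulmxK // mul0mx.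
by rewrite mul0mx.
Qed.

Lemma row_eq0_rank (K : fieldType) n d (M : 'M[K]_(n, d)) i :
  (row i M == 0) = (\rank (sel K [set i] *m M) == 0%N).
Proof.
rewrite mxrank_eq0; apply/eqP/eqP => [r0|s0].
  apply/row_matrixP => j; rewrite row_sel row0 inE.
  by case: eqP => [->|]; rewrite ?r0 ?scaler0 ?scale0r.
by have := congr1 (row i) s0; rewrite row_sel row0 inE eqxx scale1r.
Qed.

(** Two columns of the same support differ by the quotients of their entries. *)
Lemma torus_equiv_col (K : fieldType) n (M M' : 'M[K]_(n, 1)) :
  (forall i, (row i M' == 0) = (row i M == 0)) -> torus_equiv M M'.
Proof.
move=> MM'.
have MM i : (M' i 0 == 0) = (M i 0 == 0).
  have r0 (N : 'M[K]_(n, 1)) : (row i N == 0) = (N i 0 == 0).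
    apply/eqP/eqP => [/rowP/(_ 0)|N0]; first by rewrite !mxE.
    by apply/rowP => j; rewrite !mxE (ord1 j).
  by rewrite -!r0.
exists (\row_i (if M i 0 == 0 then 1 else M' i 0 / M i 0)); split.
  move=> i; rewrite mxE; case: ifPn => [_|M0]; first exact: oner_neq0.
  by rewrite mulf_neq0 ?invr_eq0 // MM.
exists 1%:M; first exact: unitmx1.
rewrite mulmx1; apply/matrixP => i j; rewrite mul_diag_mx !mxE (ord1 j).
case: ifPn => [M0|M0]; last by rewrite divfK.
by rewrite mul1r (eqP M0); apply/eqP; rewrite MM.
Qed.

(** The Pluecker coordinates of M, which decide which rows are parallel. *)
Definition rdet {K : fieldType} {n : nat} (M : 'M[K]_(n, 2)) (i j : 'I_n) : K :=
  M i 0 * M j 1 - M j 0 * M i 1.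

Lemma ord2P (j : 'I_2) : j = 0 \/ j = 1.
Proof. by case: j => [[|[|//]] ?]; [left|right]; apply: val_inj. Qed.

Lemma row2P (K : fieldType) n (M : 'M[K]_(n, 2)) i :
  (row i M == 0) = (M i 0 == 0) && (M i 1 == 0).
Proof.
apply/eqP/andP => [/rowP r0|[/eqP e0 /eqP e1]].
  by have := r0 0; have := r0 1; rewrite !mxE => -> ->.
by apply/rowP => j; rewrite !mxE; case: (ord2P j) => ->.
Qed.

Lemma rdet_sel (K : fieldType) n (J : {set 'I_n}) (M : 'M[K]_(n, 2)) i j :
  i \in J -> j \in J -> rdet (sel K J *m M) i j = rdet M i j.
Proof. by move=> iJ jJ; rewrite /rdet /sel !mul_diag_mx !mxE iJ jJ !mul1r. Qed.

Lemma rdet_rank2 (K : fieldType) n (M : 'M[K]_(n, 2)) i j :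
  rdet M i j != 0 -> \rank M = 2%N.
Proof.
move=> dM; apply/eqP; rewrite eqn_leq rank_leq_col /=.
(* C inverts the minor formed by the rows i and j, up to its determinant. *)
pose C : 'M[K]_(2, n) :=
  \matrix_(k, l) (if k == 0 then M j 1 *+ (l == i) - M i 1 *+ (l == j)
    else M i 0 *+ (l == j) - M j 0 *+ (l == i)).
have CM : C *m M = (rdet M i j)%:M.
  apply/matrixP => k l; rewrite !mxE.
  under eq_bigr => m _ do rewrite mxE.
  have S (a b : K) (i' j' : 'I_n) :
      \sum_m (a *+ (m == i') - b *+ (m == j')) * M m l
      = a * M i' l - b * M j' l.
    have S1 (e : K) i1 : \sum_m (e *+ (m == i1)) * M m l = e * M i1 l.
      rewrite (bigD1 i1) //= eqxx mulr1n big1 ?addr0 // => m /negPf->.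
      by rewrite mulr0n mul0r.
    by under eq_bigr => m _ do rewrite mulrBl; rewrite sumrB !S1.
  case: (ord2P k) => ->; rewrite /= S; case: (ord2P l) => ->;
    rewrite /rdet /= ?mulr1n ?mulr0n; ring.
have := mxrankM_maxr C M; rewrite CM.
suff -> : \rank ((rdet M i j)%:M : 'M_2) = 2%N by [].
by apply: mxrank_unit; rewrite unitmxE det_scalar unitfE expf_neq0.
Qed.

Lemma rdet0_rank1 (K : fieldType) n (M : 'M[K]_(n, 2)) :
  (forall i j, rdet M i j = 0) -> (\rank M <= 1)%N.
Proof.
move=> dM; have [r0|] := boolP [forall i, row i M == 0].
  suff -> : M = 0 by rewrite mxrank0.
  by apply/row_matrixP => i; rewrite row0; apply/eqP/(forallP r0).
case/forallPn => i Mi; apply: leq_trans (rank_leq_row (row i M)).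
apply/mxrankS/row_subP => j.
have [y0|y0] := eqVneq (M i 1) 0.
  have x0 : M i 0 != 0 by move: Mi; rewrite row2P y0 eqxx andbT.
  apply/submxP; exists (M j 0 / M i 0)%:M; rewrite mul_scalar_mx.
  have dij := dM i j; apply/rowP => k; rewrite !mxE.
  case: (ord2P k) => ->; first by rewrite divfK.
  apply/(mulfI x0); rewrite y0 !mulr0; move: dij.
  by rewrite /rdet y0 mulr0 subr0.
apply/submxP; exists (M j 1 / M i 1)%:M; rewrite mul_scalar_mx.
have dij := dM i j; apply/rowP => k; rewrite !mxE.
case: (ord2P k) => ->; last by rewrite divfK.
apply/(mulIf y0); rewrite mulrAC divfK //.
by move/eqP: dij; rewrite /rdet subr_eq0 mulrC => /eqP.
Qed.

(** The matroid of five vectors in the plane: label 0 marks the zero rows and two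
nonzero rows have the same label when they are parallel. *)
Definition pattern {K : fieldType} (M : 'M[K]_(5, 2)) (lab : 'I_5 -> nat) :
    Prop :=
  (forall i, (row i M == 0) = (lab i == 0%N)) /\
  forall i j,
    (rdet M i j == 0) = [|| lab i == 0%N, lab j == 0%N | lab i == lab j].

(** The labels of the classes are 1 .. k without gaps, so that k counts the
classes; label 0 may or may not occur. *)
Definition complete_labels (lab : 'I_5 -> nat) (k : nat) : Prop :=
  (forall i, lab i <= k)%N /\
  forall l, (0 < l <= k)%N -> exists i, lab i = l.

Definition nb_labels (lab : 'I_5 -> nat) (J : {set 'I_5}) : nat :=
  size (undup [seq l <- [seq lab i | i <- enum J] | l != 0%N]).

Lemma mem_labels (lab : 'I_5 -> nat) (J : {set 'I_5}) l :
  reflect (exists2 i, i \in J & lab i = l /\ l <> 0%N)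
    (l \in undup [seq l <- [seq lab i | i <- enum J] | l != 0%N]).
Proof.
rewrite mem_undup mem_filter; apply: (iffP andP).
  by case=> /eqP l0 /mapP[i]; rewrite mem_enum => iJ lE; exists i; rewrite -?lE.
case=> i iJ [<- /eqP l0]; split=> //.
by apply/mapP; exists i; rewrite ?mem_enum.
Qed.

(** Nonzero rows of two different labels span the plane, those of a single label
span a line. *)
Lemma rank_pattern (K : fieldType) (M : 'M[K]_(5, 2)) lab J :
  pattern M lab -> \rank (sel K J *m M) = minn 2 (nb_labels lab J).
Proof.
case=> r0 d0; rewrite /nb_labels.
have := @mem_labels lab J.
have := undup_uniq [seq l <- [seq lab i | i <- enum J] | l != 0%N].
case: (undup _) => [_ m|x [_ m|y s]].
- rewrite minn0; apply/eqP; rewrite mxrank_eq0; apply/eqP/row_matrixP => i.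
  rewrite row_sel row0; case: (boolP (i \in J)) => iJ; last by rewrite scale0r.
  rewrite scale1r; apply/eqP; rewrite r0; apply/eqP.
  have [//|/eqP l0] := eqVneq (lab i) 0%N.
  suff : lab i \in [::] by [].
  by apply/m; exists i.
- have /m[i iJ [li x0]] : x \in [:: x] by rewrite inE.
  apply/eqP; rewrite eqn_leq; apply/andP; split.
    apply: rdet0_rank1 => i1 i2; have [i1J|i1J] := boolP (i1 \in J); last first.
      by rewrite /rdet /sel !mul_diag_mx !mxE (negPf i1J) !mul0r mulr0 subrr.
    have [i2J|i2J] := boolP (i2 \in J); last first.
      by rewrite /rdet /sel !mul_diag_mx !mxE (negPf i2J) !mul0r mulr0 subrr.
    rewrite rdet_sel //; apply/eqP; rewrite d0.
    have [//|/eqP l1] := eqVneq (lab i1) 0%N.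
    have [//|/eqP l2] := eqVneq (lab i2) 0%N.
    have : lab i1 \in [:: x] by apply/m; exists i1.
    have : lab i2 \in [:: x] by apply/m; exists i2.
    by rewrite !inE => /eqP-> /eqP->; rewrite eqxx !orbT.
  rewrite lt0n mxrank_eq0; apply/eqP => /(congr1 (row i)).
  rewrite row_sel iJ scale1r row0 => /eqP; rewrite r0 li => /eqP; exact: x0.
- rewrite /= inE negb_or => /andP[/andP[xy _] _] m.
  have /m[i iJ [li x0]] : x \in [:: x, y & s] by rewrite inE eqxx.
  have /m[j jJ [lj y0]] : y \in [:: x, y & s] by rewrite !inE eqxx orbT.
  have -> : minn 2 (size s).+2 = 2%N by apply/minn_idPl.
  apply: (@rdet_rank2 _ _ _ i j); rewrite rdet_sel // d0 li lj.
  by rewrite (negPf xy) (introF eqP x0) (introF eqP y0).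
Qed.

(** The row ranks determine which rows vanish and which minors vanish, hence the
pattern, and conversely by [rank_pattern]. *)
Lemma pattern_rank (K : fieldType) (M M0 : 'M[K]_(5, 2)) lab :
  pattern M0 lab ->
  (forall J, \rank (sel K J *m M) = \rank (sel K J *m M0)) <-> pattern M lab.
Proof.
move=> p0; split=> [MM0|p J]; last first.
  by rewrite (rank_pattern _ p) (rank_pattern _ p0).
split=> [i|i j]; first by rewrite row_eq0_rank MM0 -row_eq0_rank p0.1.
rewrite -p0.2.
have dr (N : 'M[K]_(5, 2)) :
    (rdet N i j == 0) = (\rank (sel K [set i; j] *m N) <= 1)%N.
  have ii : i \in [set i; j] by rewrite !inE eqxx.
  have jj : j \in [set i; j] by rewrite !inE eqxx orbT.
  apply/eqP/idP => [Nij|le1].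
    apply: rdet0_rank1 => i1 i2.
    have ij_in i' : (i' \notin [set i; j]) \/ i' = i \/ i' = j.
      by rewrite !inE; case: eqP => ?; case: eqP => ?; auto.
    have Nji : rdet N j i = 0 by rewrite -oppr0 -Nij /rdet; ring.
    have out i' (i'J : i' \notin [set i; j]) l :
        (sel K [set i; j] *m N) i' l = 0.
      by rewrite /sel mul_diag_mx !mxE (negPf i'J) mul0r.
    case: (ij_in i1) => [o1|i1E].
      by rewrite /rdet !(out i1 o1) mul0r mulr0 subrr.
    case: (ij_in i2) => [o2|i2E].
      by rewrite /rdet !(out i2 o2) mul0r mulr0 subrr.
    by case: i1E => ->; case: i2E => ->; rewrite rdet_sel // /rdet; ring.
  apply/eqP; apply: contraLR le1 => Nij.
  by rewrite (@rdet_rank2 _ _ _ i j) // rdet_sel.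
by rewrite !dr MM0.
Qed.

(** A point x : y of the projective line, with None at infinity: parallel rows are
recognized by an equality of slopes. *)
Definition slope {K : fieldType} (x y : K) : option K :=
  if y == 0 then None else Some (x / y).

Lemma slope_eq (K : fieldType) (x y x' y' : K) :
  ~~ ((x == 0) && (y == 0)) -> ~~ ((x' == 0) && (y' == 0)) ->
  (slope x y == slope x' y') = (x * y' - x' * y == 0).
Proof.
rewrite /slope; have [->|y0] := eqVneq y 0; have [->|y'0] := eqVneq y' 0;
  rewrite ?andbT ?andbF ?mulr0 ?subrr ?eqxx ?subr0 ?sub0r ?oppr_eq0 //.
- by move=> x0 _; rewrite mulf_eq0 (negPf x0) (negPf y'0).
- by move=> _ x0; rewrite mulf_eq0 (negPf x0) (negPf y0).
move=> _ _; apply/eqP/eqP => [[e]|e].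
  by rewrite -(divfK y0 x) e mulrAC divfK // subrr.
congr Some; apply/(mulIf y0)/(mulIf y'0); rewrite divfK // mulrAC divfK //.
by apply/eqP; rewrite -subr_eq0 e.
Qed.

Lemma exists_labels (K : fieldType) (M : 'M[K]_(5, 2)) :
  exists lab k, pattern M lab /\ complete_labels lab k.
Proof.
(* The label of a nonzero row is one plus the position of its slope
   among the slopes that occur. *)
pose sl i := slope (M i 0) (M i 1).
pose reps := undup [seq sl i | i <- enum 'I_5 & row i M != 0].
pose lab i := if row i M == 0 then 0%N else (index (sl i) reps).+1.
have repsP i : row i M != 0 -> sl i \in reps.
  by move=> Mi; rewrite mem_undup map_f // mem_filter Mi mem_enum.
exists lab, (size reps); split; first split.
- by move=> i; rewrite /lab; case: ifP.
- move=> i j; rewrite /lab.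
  have [Mi|Mi] := eqVneq (row i M) 0.
    move/eqP: Mi; rewrite /= /rdet row2P => /andP[/eqP-> /eqP->].
    by rewrite mul0r mulr0 subrr eqxx.
  have [Mj|Mj] := eqVneq (row j M) 0.
    move/eqP: Mj; rewrite /= /rdet row2P => /andP[/eqP-> /eqP->].
    by rewrite mul0r mulr0 subrr eqxx.
  rewrite /= eqSS /rdet -slope_eq -?row2P //.
  apply/eqP/eqP => [e|]; first by congr index.
  by move/(congr1 (nth None reps)); rewrite !nth_index ?repsP.
split.
  move=> i; rewrite /lab; case: eqP => // /eqP Mi.
  by rewrite index_mem repsP.
case=> // l lr.
have := mem_nth None lr; rewrite mem_undup => /mapP[i].
rewrite mem_filter => /andP[Mi _] e; exists i.
by rewrite /lab (negPf Mi) /sl -/(sl i) -e index_uniq ?undup_uniq.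
Qed.

End Patterns.

(** * Normal forms and the orbits in a fibre *)

Section NormalForms.

Local Open Scope set_scope.
Local Open Scope ring_scope.

(** The rows of a normal form by label: the zero vector, the three points that a
projectivity can place at will, and two points of parameters p.1 and p.2. *)
Definition nf_point {K : fieldType} (p : K * K) (l : nat) : K * K :=
  nth (p.2, 1) [:: (0, 0); (1, 0); (0, 1); (1, 1); (p.1, 1)] l.

Definition normal_form {K : fieldType} (lab : 'I_5 -> nat) (p : K * K) :
    'M[K]_(5, 2) :=
  \matrix_(i, j)
    (if j == 0 then (nf_point p (lab i)).1 else (nf_point p (lab i)).2).

(** The k points listed in [nf_point] are pairwise distinct. *)
Definition admissible {K : fieldType} (k : nat) (p : K * K) : Prop :=
  ((4 <= k)%N -> p.1 != 0 /\ p.1 != 1) /\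
  ((5 <= k)%N -> [/\ p.2 != 0, p.2 != 1 & p.1 != p.2]).

Lemma normal_form_pattern (K : fieldType) lab k (p : K * K) :
  (k <= 5)%N -> (forall i, lab i <= k)%N -> admissible k p ->
  pattern (normal_form lab p) lab.
Proof.
case: p => s t k5 labk [/= ads adt].
split=> [i|i j].
  rewrite row2P !mxE /=; have := labk i.
  by case: (lab i) => [|[|[|[|[|l]]]]] _;
    rewrite /nf_point /= ?nth_nil /= ?eqxx ?oner_eq0 ?andbF.
rewrite /rdet !mxE /=; have := labk i; have := labk j.
have simp := (mul1r, mulr1, mul0r, mulr0, subrr, subr0, sub0r, oppr_eq0,
  oner_eq0, eqxx, subr_eq0).
case: (lab i) => [|[|[|[|[|[|l]]]]]];
  case: (lab j) => [|[|[|[|[|[|m]]]]]] lj li;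
  rewrite /nf_point /= !simp ?[1 == _]eq_sym ?[t == s]eq_sym
    ?[0 == 1]eq_sym ?[0 == s]eq_sym ?[0 == t]eq_sym ?oner_eq0 //;
  first [by case: ads; [lia | move=> /negPf? /negPf?]
       | by case: adt; [lia | move=> /negPf? /negPf? /negPf?]
       | by exfalso; lia].
Qed.

Lemma torus_equivE (K : fieldType) n (c : 'rV[K]_n) (M : 'M[K]_(n, 2))
    (h : 'M[K]_2) i j :
  (diag_mx c *m M *m h) i j = c 0 i * (M i 0 * h 0 j + M i 1 * h 1 j).
Proof.
rewrite -mulmxA mul_diag_mx !mxE big_ord_recl big_ord1.
by congr (_ * (_ * h _ _ + M _ _ * h _ _)); apply: val_inj.
Qed.

Lemma det2E (K : fieldType) (h : 'M[K]_2) :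
  \det h = h 0 0 * h 1 1 - h 0 1 * h 1 0.
Proof.
rewrite (expand_det_row _ 0) big_ord_recl big_ord1 /cofactor !det_mx11 !mxE /=.
have -> : lift 0 (0 : 'I_1) = 1 :> 'I_2 by apply: val_inj.
have -> : lift (1 : 'I_2) (0 : 'I_1) = 0 :> 'I_2 by apply: val_inj.
by rewrite expr0 expr1 mul1r mulN1r mulrN.
Qed.

(** Coordinates in which the rows of labels 1 and 2 lie on the axes are unique up
to scaling each coordinate; the ratio of the scalings is fixed by asking that
the row of label 3, if any, lies on the diagonal. Every nonzero row is then
rescaled to have last nonzero coordinate 1. Parallel rows get the same normal form by the
Pluecker relation. *)
Lemma to_normal_form (K : fieldType) (M : 'M[K]_(5, 2)) lab k :
  pattern M lab -> complete_labels lab k -> (2 <= k <= 5)%N ->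
  exists p, torus_equiv (normal_form lab p) M.
Proof.
case=> r0 d0 [labk occ] /andP[k2 k5].
pose rep l := odflt ord0 [pick i | lab i == l].
have repE l : (0 < l <= k)%N -> lab (rep l) = l.
  move=> lk; rewrite /rep; case: pickP => [i /eqP //|no].
  by have [i li] := occ l lk; have := no i; rewrite li eqxx.
pose d i j := rdet M i j.
(* The new coordinates of a row are its minors with the rows of labels 2 and 1,
   which vanish on these rows; the factors al and be make the two coordinates of
   the row of label 3 equal, both being the product of its two minors. *)
pose al := if (3 <= k)%N then d (rep 1%N) (rep 3%N) else 1.
pose be := if (3 <= k)%N then d (rep 3%N) (rep 2%N) else 1.
pose f i := al * d i (rep 2%N).
pose g i := be * d (rep 1%N) i.
have l1 := repE 1%N; have l2 := repE 2%N; have l3 := repE 3%N.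
rewrite k2 (ltnW k2) in l1 l2; have {}l1 := l1 isT; have {}l2 := l2 isT.
have al0 : al != 0.
  by rewrite /al; case: ifP => [k3|]; rewrite ?oner_neq0 // d0 l1 l3.
have be0 : be != 0.
  by rewrite /be; case: ifP => [k3|]; rewrite ?oner_neq0 // d0 l2 l3.
have d12 : d (rep 1%N) (rep 2%N) != 0 by rewrite d0 l1 l2.
have f0 i : (f i == 0) = (lab i == 0%N) || (lab i == 2%N).
  by rewrite mulf_eq0 (negPf al0) d0 l2.
have g0 i : (g i == 0) = (lab i == 0%N) || (lab i == 1%N).
  by rewrite mulf_eq0 (negPf be0) d0 l1 /= [1%N == _]eq_sym.
have ratio i j : lab i = lab j -> (3 <= lab i)%N -> f i / g i = f j / g j.
  move=> ij i3; have dij : d i j = 0 by apply/eqP; rewrite d0 ij eqxx !orbT.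
  have gi : g i != 0 by rewrite g0; lia.
  have gj : g j != 0 by rewrite g0; lia.
  apply/eqP; rewrite eqr_div // -subr_eq0; apply/eqP.
  (* The Pluecker relation between the rows i, j and those of labels 1, 2. *)
  have -> : f i * g j - f j * g i
      = al * be * d (rep 1%N) (rep 2%N) * d i j by rewrite /f /g /d /rdet; ring.
  by rewrite dij mulr0.
have ratio3 i : lab i = 3%N -> f i = g i.
  move=> i3; have k3 : (3 <= k)%N by rewrite -i3.
  have gi : g i != 0 by rewrite g0 i3.
  have g3 : g (rep 3%N) != 0 by rewrite g0 l3.
  have fg3 : f (rep 3%N) = g (rep 3%N) by rewrite /f /g /al /be k3 mulrC.
  have : f i / g i = f (rep 3%N) / g (rep 3%N) by apply: ratio; rewrite i3 ?l3.
  by rewrite fg3 divff // => /(canRL (divfK gi)); rewrite mul1r.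
pose s := f (rep 4%N) / g (rep 4%N).
pose t := f (rep 5%N) / g (rep 5%N).
exists (s, t); apply: torus_equiv_sym.
pose x i := M i 0; pose y i := M i 1.
exists (\row_i (if lab i == 0%N then 1
  else if lab i == 1%N then (f i)^-1 else (g i)^-1)).
split.
  move=> i; rewrite mxE; case: ifPn => [_|i0]; first exact: oner_neq0.
  case: ifPn => i1; rewrite invr_eq0 ?f0 ?g0 negb_or i0 //=.
  by rewrite (eqP i1).
pose h : 'M[K]_2 := \matrix_(a, b)
  (if b == 0 then (if a == 0 then al * y (rep 2%N) else - (al * x (rep 2%N)))
   else (if a == 0 then - (be * y (rep 1%N)) else be * x (rep 1%N))).
exists h.
  rewrite unitmxE unitfE det2E !mxE /=.
  have -> : al * y (rep 2%N) * (be * x (rep 1%N)) -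
      - (be * y (rep 1%N)) * - (al * x (rep 2%N))
      = al * be * d (rep 1%N) (rep 2%N).
    by rewrite /d /rdet /x /y; ring.
  by rewrite !mulf_neq0.
apply/matrixP => i j; rewrite torus_equivE !mxE /=.
have fE : x i * (al * y (rep 2%N)) + y i * - (al * x (rep 2%N)) = f i.
  by rewrite /f /d /rdet /x /y; ring.
have gE : x i * - (be * y (rep 1%N)) + y i * (be * x (rep 1%N)) = g i.
  by rewrite /g /d /rdet /x /y; ring.
have -> : M i 0 * (if j == 0 then al * y (rep 2%N) else - (be * y (rep 1%N))) +
  M i 1 * (if j == 0 then - (al * x (rep 2%N)) else be * x (rep 1%N))
    = if j == 0 then f i else g i.
  by rewrite -fE -gE; case: (j == 0).
have fi := f0 i; have gi := g0 i.
have R : (3 <= lab i)%N -> f i / g i = (nf_point (s, t) (lab i)).1.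
  have := labk i; case li : (lab i) => [|[|[|[|[|[|l]]]]]] // lik _.
  - by rewrite (ratio3 _ li) divff // g0 li.
  - by apply: ratio; rewrite ?li // repE // lik.
  - by apply: ratio; rewrite ?li // repE // lik.
  - by exfalso; lia.
have Y : (2 <= lab i)%N -> (nf_point (s, t) (lab i)).2 = 1.
  by case: (lab i) => [|[|[|[|[|l]]]]] //= _; rewrite /nf_point /= nth_nil.
case: (ltnP 2 (lab i)) => i3.
  have [n0 n1] : (lab i == 0%N) = false /\ (lab i == 1%N) = false by lia.
  rewrite n0 n1 in gi *; case: ifP => _; first by rewrite mulrC -R.
  by rewrite mulVf ?gi // Y // ltnW.
case: (lab i) i3 fi gi => [|[|[|//]]] _ /= fi gi;
  rewrite /nf_point /=; case: (j == 0); rewrite ?mulVf ?fi ?gi //.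
- by rewrite (eqP fi) mulr0.
- by rewrite (eqP gi) mulr0.
- by rewrite (eqP gi) mulr0.
- by rewrite (eqP fi) mulr0.
Qed.

(** The minors are multiplied by nonzero factors. *)
Lemma torus_equiv_pattern (K : fieldType) (M M' : 'M[K]_(5, 2)) lab :
  torus_equiv M M' -> pattern M lab -> pattern M' lab.
Proof.
move=> MM' [r0 d0]; split=> [i|i j].
  by rewrite (torus_equiv_row_eq0 _ MM').
case: MM' => c [uc [h uh ->]].
have -> : rdet (diag_mx c *m M *m h) i j = c 0 i * c 0 j * \det h * rdet M i j.
  by rewrite /rdet !torus_equivE det2E; ring.
have dh : \det h != 0 by rewrite -unitfE -unitmxE.
by rewrite -d0 !mulf_eq0 (negPf (uc i)) (negPf (uc j)) (negPf dh).
Qed.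

Lemma normal_form_admissible (K : fieldType) lab k (p : K * K) :
  complete_labels lab k -> pattern (normal_form lab p) lab -> admissible k p.
Proof.
case: p => s t [_ occ] [_ d0]; split=> /= k4.
  have [|i2 e2] := occ 2%N; first by lia.
  have [|i3 e3] := occ 3%N; first by lia.
  have [|i4 e4] := occ 4%N; first by lia.
  have := d0 i4 i2; have := d0 i4 i3; rewrite /rdet !mxE e2 e3 e4 /nf_point /=.
  by rewrite !(mulr1, mul1r, mul0r, subr0, subr_eq0) => -> ->.
have [|i2 e2] := occ 2%N; first by lia.
have [|i3 e3] := occ 3%N; first by lia.
have [|i4 e4] := occ 4%N; first by lia.
have [|i5 e5] := occ 5%N; first by lia.
have := d0 i5 i2; have := d0 i5 i3; have := d0 i4 i5.
rewrite /rdet !mxE e2 e3 e4 e5 /nf_point /=.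
by rewrite !(mulr1, mul1r, mul0r, subr0, subr_eq0) => -> -> ->.
Qed.

(** A change of coordinates that fixes the points 1:0, 0:1 and 1:1 is a scalar, so
the remaining points are invariants. *)
Lemma normal_form_inj (K : fieldType) lab k (p p' : K * K) :
  complete_labels lab k -> (4 <= k)%N ->
  torus_equiv (normal_form lab p) (normal_form lab p') ->
  p.1 = p'.1 /\ ((5 <= k)%N -> p.2 = p'.2).
Proof.
case: p p' => s t [s' t'] [_ occ] k4 [c [uc [h uh E]]] /=.
have Eij i j := congr1 (fun N : 'M_(5, 2) => N i j) E.
have [|i1 e1] := occ 1%N; first by lia.
have [|i2 e2] := occ 2%N; first by lia.
have [|i3 e3] := occ 3%N; first by lia.
have := Eij i1 1; have := Eij i2 0; have := Eij i3 0; have := Eij i3 1.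
rewrite !torus_equivE !mxE e1 e2 e3 /nf_point /=.
rewrite !(mul1r, mul0r, add0r, addr0) => h3 h3' /esym/eqP h20 /esym/eqP h11.
move: h20 h11; rewrite !mulf_eq0 !(negPf (uc _)) /= => /eqP h10 /eqP h01.
move: h3 h3'; rewrite h10 h01 addr0 add0r => h3 h3'.
have hh : h 0 0 = h 1 1 by apply: (mulfI (uc i3)); rewrite -h3 -h3'.
have coordinate l u u' : nf_point (s, t) l = (u, 1) ->
    nf_point (s', t') l = (u', 1) -> (0 < l <= k)%N -> u = u'.
  move=> eu eu' lk; have [i li] := occ l lk.
  have := Eij i 0; have := Eij i 1.
  rewrite !torus_equivE !mxE li eu eu' /= h10 h01 hh.
  rewrite !(mulr0, mul1r, add0r, addr0) => ch.
  by rewrite mulrCA -ch mulr1.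
split; first by apply: (coordinate 4%N) => //; lia.
by move=> k5; apply: (coordinate 5%N).
Qed.

Lemma torus_equiv_refl (K : fieldType) n d (M : 'M[K]_(n, d)) : torus_equiv M M.
Proof.
exists (const_mx 1); split; first by move=> i; rewrite mxE oner_neq0.
by exists 1%:M; rewrite ?unitmx1 // diag_const_mx mul1mx mulmx1.
Qed.

Lemma GL_orbit_refl (K : fieldType) (v : conf K) : GL_orbit v v.
Proof.
have [A Av] := exists_spans v; apply/(GL_orbitP Av Av); exact: torus_equiv_refl.
Qed.

Lemma GL_orbit_eq (K : fieldType) (v v' : conf K) :
  GL_orbit v v' -> GL_orbit v = GL_orbit v'.
Proof.
have [A Av] := exists_spans v; have [A' Av'] := exists_spans v'.
rewrite (GL_orbitP Av Av') => e; apply/predeqP => w.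
have [B Bw] := exists_spans w; rewrite (GL_orbitP Av Bw) (GL_orbitP Av' Bw).
split; first exact: (torus_equiv_trans (torus_equiv_sym e)).
exact: (torus_equiv_trans e).
Qed.

Section Fibre.
Variables (K : fieldType) (phi : {ffun {set 'I_5} -> nat}) (d : nat).
Variables (code : 'M[K]_(5, d) -> conf K -> Prop) (rho : {set 'I_5} -> nat).
Hypothesis code_phi : encoding phi code rho.

Let profile (M : 'M[K]_(5, d)) := forall J, \rank (sel K J *m M) = rho J.

Lemma fibre_single_orbit (v : conf K) :
  (forall M M', profile M -> profile M' -> torus_equiv M M') ->
  fibre phi v -> fibre phi = GL_orbit v.
Proof.
move=> one fv; case: code_phi => surj real pr orb.
have [M Mv] := surj v fv; apply/predeqP => w; split; last first.
  by move/(fibre_GL_stable fv).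
move=> fw; have [N Nw] := surj w fw.
by apply/(orb _ _ _ _ Mv Nw); apply: one; [apply/(pr _ _ Mv)|apply/(pr _ _ Nw)].
Qed.

Lemma fibre_orbits_param (T : choiceType) (P : set T) (nf : T -> 'M[K]_(5, d)) :
  (forall p, P p -> profile (nf p)) ->
  (forall M, profile M -> exists2 p, P p & torus_equiv (nf p) M) ->
  (forall p q, P p -> P q -> torus_equiv (nf p) (nf q) -> p = q) ->
  (@fibre_orbits K phi #= P)%card.
Proof.
move=> prof norm inj; case: code_phi => surj real pr orb.
(* All configurations encoded by nf p lie in one orbit; taking the union of their
   orbits makes it a function of p without a choice of a configuration. *)
pose g p : set (conf K) :=
  [set v | exists2 w, code (nf p) w & GL_orbit w v]%classic.
have gE p w : code (nf p) w -> g p = GL_orbit w.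
  move=> pw; apply/predeqP => v; split=> [[w' pw' w'v]|wv]; last by exists w.
  rewrite (@GL_orbit_eq _ w w') //.
  by apply/(orb _ _ _ _ pw pw'); apply: torus_equiv_refl.
suff -> : @fibre_orbits K phi = (g @` P)%classic.
  apply: inj_card_eq => p q; rewrite !inE => Pp Pq.
  have [v pv] := real _ (prof p Pp); have [w qw] := real _ (prof q Pq).
  rewrite (gE _ _ pv) (gE _ _ qw) => vw; apply: inj => //.
  apply/(orb _ _ _ _ pv qw); rewrite vw; exact: GL_orbit_refl.
apply/predeqP => O; split=> [[v fv <-]|[p Pp <-]].
  have [M Mv] := surj v fv.
  have [|p Pp pM] := norm M; first exact/(pr _ _ Mv).
  exists p => //; have [w pw] := real _ (prof p Pp).
  by rewrite (gE _ _ pw); apply: GL_orbit_eq; apply/(orb _ _ _ _ pw Mv).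
have [w pw] := real _ (prof p Pp); exists w; last by rewrite (gE _ _ pw).
by apply/(pr _ _ pw); apply: prof.
Qed.
End Fibre.

Lemma fibre_two_rows (K : fieldType) (phi : {ffun {set 'I_5} -> nat})
    (code : 'M[K]_(5, 2) -> conf K -> Prop) (rho : {set 'I_5} -> nat)
    (M0 : 'M[K]_(5, 2)) (v : conf K) lab k :
  encoding phi code rho -> fibre phi v -> code M0 v -> pattern M0 lab ->
  complete_labels lab k -> (2 <= k <= 5)%N ->
  [/\ (k <= 3)%N -> fibre phi = GL_orbit v,
      k = 4 -> (@fibre_orbits K phi #= [set s : K | s != 0 /\ s != 1])%card
    & k = 5 -> (@fibre_orbits K phi #= [set p : K * K | admissible 5 p])%card].
Proof.
move=> enc fv Mv p0 ck k25; have := k25 => /andP[k2 k5].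
have profP (M : 'M[K]_(5, 2)) :
    (forall J, \rank (sel K J *m M) = rho J) <-> pattern M lab.
  case: enc => _ _ pr _; have r0 := (pr _ _ Mv).1 fv.
  by rewrite -(pattern_rank M p0); split=> h J; rewrite h r0.
have norm M : pattern M lab ->
    exists2 p, admissible k p & torus_equiv (normal_form lab p) M.
  move=> pM; have [p pE] := to_normal_form pM ck k25; exists p => //.
  apply: (normal_form_admissible ck).
  exact: torus_equiv_pattern (torus_equiv_sym pE) pM.
split=> [k3|k4|k5'].
- apply: (fibre_single_orbit enc) => // M M'.
  move=> /profP/norm[p _ pM] /profP/norm[p' _ pM'].
  apply: torus_equiv_trans (torus_equiv_sym pM) _.
  suff -> : normal_form lab p = normal_form lab p' by [].
  apply/matrixP => i j; rewrite !mxE; have := leq_trans (ck.1 i) k3.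
  by case: (lab i) => [|[|[|[|]]]].
- have adm s : admissible k (s, 0) <-> [set s : K | s != 0 /\ s != 1]%classic s.
    rewrite /admissible k4 /=; split=> [[+ _]|s01]; last by split.
    by apply.
  apply: (fibre_orbits_param enc (nf := fun s => normal_form lab (s, 0))).
  + by move=> s /adm as_; apply/profP/(normal_form_pattern k5 ck.1 as_).
  + move=> M /profP/norm[[s t] [/= as_ _] sM]; exists s.
      by apply: as_; rewrite k4.
    suff -> : normal_form lab (s, 0) = normal_form lab (s, t) by [].
    apply/matrixP => i j; rewrite !mxE; have := ck.1 i; rewrite k4.
    by case: (lab i) => [|[|[|[|[|]]]]].
  + by move=> s s' _ _ /(normal_form_inj ck); rewrite k4 => /(_ isT)[].
- apply: (fibre_orbits_param enc (nf := normal_form lab)).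
  + by move=> p ap; apply/profP/(normal_form_pattern k5 ck.1); rewrite k5'.
  + by move=> M /profP/norm[p ap pM]; exists p => //; move: ap; rewrite k5'.
  + move=> [s t] [s' t'] _ _ /(normal_form_inj ck); rewrite k5'.
    by case/(_ isT) => /= -> ->.
Qed.

(** For matrices with a single column the row ranks are the support. *)
Lemma fibre_one_row (K : fieldType) (phi : {ffun {set 'I_5} -> nat})
    (code : 'M[K]_(5, 1) -> conf K -> Prop) (rho : {set 'I_5} -> nat)
    (v : conf K) :
  encoding phi code rho -> fibre phi v -> fibre phi = GL_orbit v.
Proof.
move=> enc; apply: (fibre_single_orbit enc) => M M' rM rM'.
by apply: torus_equiv_col => i; rewrite !row_eq0_rank rM rM'.
Qed.

End NormalForms.

(** * Counting the faces *)

Section Faces.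

Local Open Scope set_scope.
Local Open Scope ring_scope.

Section Enumeration.
Local Open Scope nat_scope.

(** Over two letters the words of length 5 enumerate the subsets of the indices,
over six letters the labellings. *)
Fixpoint words {T : Type} (s : seq T) (n : nat) : seq (seq T) :=
  if n is n'.+1 then [seq x :: w | x <- s, w <- words s n'] else [:: [::]].

Lemma mem_words (T : eqType) (s : seq T) n w :
  (w \in words s n) = (size w == n) && all (mem s) w.
Proof.
elim: n w => [|n IHn] [|x w] //=.
  by apply/negbTE/allpairsP => -[[? ?] [_ _]].
rewrite eqSS andbCA -IHn.
apply/allpairsP/andP => [[[y u] [/= ys un [-> ->]]]|[xs wn]] //.
by exists (x, w).
Qed.

Lemma words_uniq (T : eqType) (s : seq T) n : uniq s -> uniq (words s n).
Proof.
move=> us; elim: n => //= n IHn; apply: allpairs_uniq => //.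
by move=> [x w] [y u] _ _ /= [-> ->].
Qed.

Definition bits : seq (seq bool) := words [:: true; false] 5.

Lemma mem_bits b : (b \in bits) = (size b == 5).
Proof. by rewrite mem_words; case: (_ == _) => //=; apply/allP => -[]. Qed.

Definition set_of_bits (b : seq bool) : {set 'I_5} :=
  [set i : 'I_5 | nth false b i].

Definition bits_of_set (J : {set 'I_5}) : seq bool :=
  [seq i \in J | i <- enum 'I_5].

Lemma bits_of_setK : cancel bits_of_set set_of_bits.
Proof.
move=> J; apply/setP => i; rewrite inE (nth_map i) ?size_enum_ord //.
by rewrite nth_ord_enum.
Qed.

Lemma bits_of_set_bits J : bits_of_set J \in bits.
Proof. by rewrite mem_bits size_map size_enum_ord. Qed.

Definition sub_bits (b b' : seq bool) : bool :=
  all (fun n => nth false b n ==> nth false b' n) (iota 0 5).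

Lemma sub_bitsE b b' : (set_of_bits b \subset set_of_bits b') = sub_bits b b'.
Proof.
apply/fintype.subsetP/allP => h i; last first.
  by rewrite !inE; apply/implyP/h; rewrite mem_iota /= add0n ltn_ord.
rewrite mem_iota => /= i5; have := h (Ordinal i5).
by rewrite !inE /= => hi; apply/implyP.
Qed.

Lemma set_of_bits_inj : {in bits &, injective set_of_bits}.
Proof.
move=> b b'; rewrite !mem_bits => /eqP sb /eqP sb' bb'.
apply: (@eq_from_nth _ false); rewrite sb ?sb' // => i i5.
by have /setP/(_ (Ordinal i5)) := bb'; rewrite !inE.
Qed.

(** The analogue of [nb_faces] for a rank function given by its table of values,
written with lists and booleans only so that it can be evaluated. *)
Definition faces (tab : seq (seq bool * nat)) (r : nat) : nat :=
  count (fun p => (p.2 == r) &&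
    all (fun q => [==> q.2 == r, sub_bits p.1 q.1 => q.1 == p.1]) tab) tab.

Definition table (f : seq bool -> nat) := [seq (b, f b) | b <- bits].

Lemma nb_faces_table (phi : {ffun {set 'I_5} -> nat}) f r :
  {in bits, forall b, phi (set_of_bits b) = f b} ->
  nb_faces phi r = faces (table f) r.
Proof.
move=> phif; rewrite /nb_faces /faces /table count_map.
pose P := [pred I : {set 'I_5} | maxset (fun J => phi J == r) I].
have -> : #|P| = count P [seq set_of_bits b | b <- bits].
  rewrite -size_filter; set e := filter _ _.
  have /card_uniqP <- : uniq e.
    rewrite filter_uniq // map_inj_in_uniq ?words_uniq //.
    exact: set_of_bits_inj.
  apply: eq_card => J; rewrite mem_filter.
  suff -> : J \in [seq set_of_bits b | b <- bits] by rewrite andbT.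
  apply/mapP; exists (bits_of_set J); first exact: bits_of_set_bits.
  by rewrite bits_of_setK.
rewrite count_map; apply: eq_in_count => b bb.
rewrite -[LHS]/(maxset _ _) -[RHS]/((f b == r) && all _ _) all_map.
apply/maxsetP/andP => [[br bmax]|[br bmax]].
  split; first by rewrite -phif.
  apply/allP => b' b'b /=; apply/implyP => b'r; apply/implyP => sbb'.
  apply/eqP/set_of_bits_inj => //; apply: bmax; rewrite ?sub_bitsE //.
  by rewrite phif.
split; first by rewrite phif.
move=> J Jr sJ; rewrite -(bits_of_setK J) in Jr sJ *.
have Jb := bits_of_set_bits J; congr set_of_bits.
have /= := allP bmax _ Jb; rewrite -phif // Jr -sub_bitsE sJ /=.
by move/eqP.
Qed.

Definition bits_labels (l : seq nat) (b : seq bool) : nat :=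
  size (undup
    [seq x <- [seq nth 0 l n | n <- iota 0 5 & nth false b n] | x != 0]).

Lemma enum_set_of_bits b :
  map val (enum (set_of_bits b)) = [seq n <- iota 0 5 | nth false b n].
Proof.
rewrite -val_enum_ord filter_map; congr map.
rewrite {1}/enum_mem -enumT /=; apply: eq_filter => i /=.
by rewrite inE.
Qed.

Lemma nb_labels_bits (lab : 'I_5 -> nat) b :
  nb_labels lab (set_of_bits b) = bits_labels [seq lab i | i <- enum 'I_5] b.
Proof.
rewrite /nb_labels /bits_labels -enum_set_of_bits -map_comp.
congr (size (undup (filter _ _))); apply: eq_map => i /=.
by rewrite (nth_map i) ?size_enum_ord // nth_ord_enum.
Qed.

Lemma card_set_of_bits b : #|set_of_bits b| = count (nth false b) (iota 0 5).
Proof. by rewrite cardE -(size_map val) enum_set_of_bits size_filter. Qed.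

Lemma setC_bits b : b \in bits -> ~: set_of_bits b = set_of_bits (map negb b).
Proof.
rewrite mem_bits => /eqP sb; apply/setP => i; rewrite !inE (nth_map false) //.
by rewrite sb.
Qed.

Definition rank2_tab (l : seq nat) := table (fun b => minn 2 (bits_labels l b)).

(** The rank formula for duality, with the subset encoded by bits. *)
Definition rank3_tab (l : seq nat) := table (fun b =>
  count (nth false b) (iota 0 5) + minn 2 (bits_labels l (map negb b)) - 2).

(** Holds for the rank function of a family of lines, and rules out the labellings
that do not come from such a family. *)
Definition loopless (tab : seq (seq bool * nat)) :=
  all (fun p => (count (nth false p.1) (iota 0 5) == 1) ==> (p.2 == 1)) tab.

Definition complete (l : seq nat) k : bool :=
  all (leq^~ k) l && all (mem l) (iota 1 k).

Definition rank2_check l k :=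
  let tab := rank2_tab l in
  [==> complete l k, loopless tab => faces tab 1 == k].

Definition rank3_check l k :=
  let tab := rank3_tab l in
  [==> complete l k, loopless tab =>
    let a := (faces tab 1, faces tab 2) in
    ((a \in [:: (5, 5); (5, 8)]) == (k == 4)) && ((a == (5, 10)) == (k == 5))].

(** The list runs through all distributions of five rows over the zero class and
five further classes, so this covers every matroid that can occur. *)
Lemma all_checks :
  all (fun l => all (fun k => rank2_check l k && rank3_check l k) (iota 2 4))
    (words (iota 0 6) 5).
(* The evaluation is left to the lazy conversion of the kernel: most lists of
   labels fail the premises of both checks, so their tables are never built. *)
Proof. exact_no_check (erefl true). Qed.

Lemma complete_labels_seq lab k (l := [seq lab i | i <- enum 'I_5]) :
  complete_labels lab k -> [/\ k <= 5, l \in words (iota 0 6) 5 & complete l k].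
Proof.
move=> [le_k occ].
have sl : size l = 5 by rewrite size_map size_enum_ord.
have ll : all (leq^~ k) l by apply/allP => _ /mapP[i _ ->].
have lk : all (mem l) (iota 1 k).
  apply/allP => x; rewrite mem_iota add1n ltnS => xk; have [i <-] := occ x xk.
  by apply: map_f; rewrite mem_enum.
have k5 : k <= 5.
  rewrite -sl -(size_iota 1 k); apply: uniq_leq_size (iota_uniq _ _) _.
  exact/allP.
split=> //; last by rewrite /complete ll lk.
rewrite mem_words sl eqxx /=; apply: sub_all ll => x xk.
suff : x \in iota 0 6 by [].
by rewrite mem_iota /= add0n ltnS (leq_trans xk).
Qed.

Lemma loopless_table (phi : {ffun {set 'I_5} -> nat}) f :
  {in bits, forall b, phi (set_of_bits b) = f b} ->
  (forall i, phi [set i] = 1) -> loopless (table f).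
Proof.
move=> phif phi1; rewrite /loopless /table all_map; apply/allP => b bb.
rewrite -[X in is_true X]/((count (nth false b) (iota 0 5) == 1) ==>
  (f b == 1)).
rewrite -card_set_of_bits -phif //; apply/implyP => /cards1P[i ->].
by rewrite phi1.
Qed.

Lemma nb_faces_rank2 (phi : {ffun {set 'I_5} -> nat}) lab k :
  complete_labels lab k -> 2 <= k ->
  (forall J, phi J = minn 2 (nb_labels lab J)) -> (forall i, phi [set i] = 1) ->
  nb_faces phi 1 = k.
Proof.
move=> ck k2 phiE phi1; have [k5 lw cl] := complete_labels_seq ck.
set l := [seq _ | _ <- _] in lw cl.
have phif : {in bits, forall b, phi (set_of_bits b) = minn 2 (bits_labels l b)}.
  by move=> b _; rewrite phiE nb_labels_bits.
rewrite (nb_faces_table _ phif); apply/eqP.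
have kI : k \in iota 2 4 by rewrite mem_iota k2.
have /andP[+ _] := allP (allP all_checks _ lw) _ kI.
by rewrite /rank2_check cl (loopless_table phif phi1).
Qed.

Lemma nb_faces_rank3 (phi : {ffun {set 'I_5} -> nat}) lab k :
  complete_labels lab k -> 2 <= k ->
  (forall J, phi J + 2 = #|J| + minn 2 (nb_labels lab (~: J))) ->
  (forall i, phi [set i] = 1) ->
  let a := (nb_faces phi 1, nb_faces phi 2) in
  ((a \in [:: (5, 5); (5, 8)]) = (k == 4)) /\ ((a == (5, 10)) = (k == 5)).
Proof.
move=> ck k2 phiE phi1; have [k5 lw cl] := complete_labels_seq ck.
set l := [seq _ | _ <- _] in lw cl.
have phif : {in bits, forall b, phi (set_of_bits b) =
    count (nth false b) (iota 0 5) + minn 2 (bits_labels l (map negb b)) - 2}.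
  move=> b bb; have := phiE (set_of_bits b).
  by rewrite setC_bits // nb_labels_bits card_set_of_bits => <-; rewrite addnK.
rewrite !(nb_faces_table _ phif).
have kI : k \in iota 2 4 by rewrite mem_iota k2.
have /andP[_] := allP (allP all_checks _ lw) _ kI.
rewrite /rank3_check cl (loopless_table phif phi1).
by case/andP => /eqP -> /eqP ->.
Qed.

(** The whole set is the only face of maximal rank. *)
Lemma nb_faces_top (phi : {ffun {set 'I_5} -> nat}) r :
  (forall J, phi J <= phi [set: 'I_5]) -> phi [set: 'I_5] <= r ->
  nb_faces phi r = (r == phi [set: 'I_5]).
Proof.
move=> mono; rewrite leq_eqVlt => /orP[/eqP<-|lt_r]; rewrite /nb_faces.
  rewrite eqxx; apply: etrans (cards1 [set: 'I_5]).
  apply: eq_card => I; rewrite !inE.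
  apply/maxsetP/eqP => [[_ max]|->].
    by rewrite (max [set: 'I_5]) ?finset.subsetT.
  by split=> // B _; rewrite finset.subTset => /eqP.
rewrite gtn_eqF //; apply: eq_card0 => I; rewrite !inE.
by apply/maxsetP => -[/eqP Ir _]; move: lt_r; rewrite -Ir ltnNge mono.
Qed.

(** The last positive entry of the sequence of the numbers of faces stands at the
rank of the whole set. *)
Lemma has_type_rank (phi : {ffun {set 'I_5} -> nat}) s :
  (forall J, phi J <= phi [set: 'I_5]) -> 0 < phi [set: 'I_5] ->
  all (leq 1) s -> has_type phi s -> phi [set: 'I_5] = (size s).+1.
Proof.
move=> mono phi0 s0 ts; apply/eqP; rewrite eqn_leq; apply/andP; split.
  rewrite leqNgt; apply/negP => lt_s.
  have := ts (phi [set: 'I_5]).-1; rewrite prednK // nb_faces_top // eqxx.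
  by rewrite nth_default // size_rcons -ltnS prednK.
rewrite leqNgt; apply/negP; rewrite ltnS => le_s.
have := ts (size s); rewrite nth_rcons ltnn eqxx nb_faces_top; last exact: leqW.
  by rewrite gtn_eqF // ltnS.
by [].
Qed.

Lemma has_type_top (phi : {ffun {set 'I_5} -> nat}) s :
  (forall J, phi J <= phi [set: 'I_5]) -> phi [set: 'I_5] = (size s).+1 ->
  (forall r, r < size s -> nb_faces phi r.+1 = nth 0 s r) -> has_type phi s.
Proof.
move=> mono phiT low r; rewrite nth_rcons; case: ltngtP => [/low //|lt_r|->].
  by rewrite nb_faces_top // phiT ?gtn_eqF // ltnS // ltnW.
by rewrite nb_faces_top // phiT ?eqxx.
Qed.

End Enumeration.

End Faces.

(** * Open dense subsets of projective spaces *)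

Section Zariski.

Local Open Scope set_scope.
Local Open Scope ring_scope.

(** A nonzero polynomial has finitely many roots and the images of the natural
numbers are distinct. *)
Lemma exists_nonroot (K : fieldType) (P : {poly K}) :
  [pchar K]%R =i pred0 -> P != 0 -> exists2 z, z != 0 & P.[z] != 0.
Proof.
move=> ch0 P0; have PX0 : P * 'X != 0 by rewrite mulf_neq0 ?polyX_eq0.
(* The factor X excludes the root 0. *)
pose s := [seq n%:R : K | n <- iota 0 (size (P * 'X))].
have us : uniq s.
  rewrite map_inj_uniq ?iota_uniq // => m n; wlog le_mn : m n / (m <= n)%N.
    by move=> W; case/orP: (leq_total m n) => [/W//|/W h /esym/h].
  move=> mn; apply/eqP; rewrite eqn_leq le_mn /= -subn_eq0.
  by rewrite -((pcharf0P K).1 ch0) natrB // -mn subrr.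
have [/(max_poly_roots PX0)/(_ us)|/allPn[z _]] :=
  boolP (all (root (P * 'X)) s).
  by rewrite size_map size_iota ltnn.
rewrite rootE hornerM hornerX mulf_eq0 negb_or => /andP[Pz z0].
by exists z.
Qed.

(** Uniqueness of the expansion in base N. *)
Lemma digits_inj (N n : nat) (f g : 'I_n -> nat) :
  (forall i, f i < N)%N -> (forall i, g i < N)%N ->
  (\sum_(i < n) f i * N ^ i = \sum_(i < n) g i * N ^ i)%N -> f =1 g.
Proof.
elim: n f g => [|n IHn] f g fN gN; first by move=> _ [].
have step (h : 'I_n.+1 -> nat) :
    (\sum_(i < n.+1) h i * N ^ i =
     (\sum_(i < n) h (lift ord0 i) * N ^ i) * N + h ord0)%N.
  rewrite big_ord_recl expn0 muln1 addnC big_distrl /=; congr addn.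
  by apply: eq_bigr => i _; rewrite /bump /= expnS; lia.
rewrite !step => e.
have e0 : f ord0 = g ord0.
  have := congr1 (modn^~ N) e.
  by rewrite !modnMDl !modn_small ?fN ?gN.
have eS : (fun i => f (lift ord0 i)) =1 (fun i => g (lift ord0 i)).
  apply: IHn => // ; move: e; rewrite e0 => /addIn/eqP.
  rewrite eqn_pmul2r; first by move/eqP.
  exact: leq_ltn_trans (fN ord0).
by move=> i; case: (unliftP ord0 i) => [j|] ->; [apply: eS|].
Qed.

(** Kronecker substitution: for N larger than all exponents in p, putting
x_i = z ^ (N ^ i) sends the monomials of p to distinct powers of z. This reduces
the claim to one variable, and for nonzero z all coordinates are nonzero. *)
Lemma exists_nonzero_value (K : fieldType) n (p : {mpoly K[n]}) :
  [pchar K]%R =i pred0 -> p != 0 ->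
  exists2 x : 'I_n -> K, (forall i, x i != 0) & p.@[x] != 0.
Proof.
move=> ch0 p0; pose N := msize p.
pose e (m : 'X_{1.. n}) := (\sum_(i < n) m i * N ^ i)%N.
have e_inj : {in msupp p &, injective e}.
  move=> m m' mp mp' em; apply/mnmP; apply: digits_inj em.
    move=> i; apply: leq_ltn_trans (msize_mdeg_lt mp).
    by rewrite mdegE (bigD1 i) //= leq_addr.
  move=> i; apply: leq_ltn_trans (msize_mdeg_lt mp').
  by rewrite mdegE (bigD1 i) //= leq_addr.
pose P : {poly K} := \sum_(m <- msupp p) p@_m *: 'X^(e m).
have P0 : P != 0.
  apply/eqP => /(congr1 (fun q : {poly K} => q`_(e (mlead p)))).
  have lp := mlead_supp p0.
  rewrite coef0 coef_sum (bigD1_seq (mlead p)) ?msupp_uniq //=.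
  rewrite coefZ coefXn eqxx mulr1 big_seq_cond big1 ?addr0 => [/eqP|m].
    by rewrite mcoeff_eq0 lp.
  case/andP=> mp /eqP ml; rewrite coefZ coefXn.
  case: eqP => [em|]; last by rewrite mulr0.
  by case: ml; apply/esym/e_inj.
have [z z0 Pz] := exists_nonroot ch0 P0.
exists (fun i => z ^+ (N ^ i)); first by move=> i; rewrite expf_neq0.
rewrite mevalE; move: Pz; rewrite horner_sum.
congr (_ != 0); apply: eq_bigr => m _; rewrite hornerZ hornerXn; congr (_ * _).
rewrite /e expr_sum; apply: eq_bigr => i _.
by rewrite -exprM mulnC.
Qed.

Lemma col_of_neq0 (K : fieldType) n (x : 'I_n.+1 -> K) :
  (forall i, x i != 0) -> \col_i x i != 0.
Proof.
move=> x0; apply/eqP => /colP/(_ ord0); rewrite !mxE => e.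
by move: (x0 ord0); rewrite e eqxx.
Qed.

Definition nonvanishing {K : fieldType} {n : nat} (q : {mpoly K[n]}) :
    set (proj K n) :=
  [set L : proj K n | exists2 x : 'cV_n, x \in val L &
    q.@[fun i => x i ord0] != 0]%classic.

(** If an open set is nonempty, some equation p of its complement has a nonzero
value and is therefore a nonzero polynomial. Then p * q has a nonzero value, and
the point where it is taken lies in both sets. *)
Lemma nonvanishing_open_dense (K : fieldType) n d (q : {mpoly K[n.+1]}) :
  [pchar K]%R =i pred0 -> q \is d.-homog -> q != 0 ->
  open_dense (@zariski_closed K n.+1) (nonvanishing q).
Proof.
move=> ch0 hq q0; split.
  exists [set q]%classic; first by move=> _ ->; exists d.
  apply/predeqP => L; split=> [nL _ -> x xL|qL [x xL /eqP]].
    by apply/eqP; apply: contrapT => /negP qx; apply: nL; exists x.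
  by apply; apply: qL.
move=> O [S hS OE] [L0 OL0].
have [p Sp p0] : exists2 p, S p & p != 0.
  apply: contrapT => noS; suff : (~` O)%classic L0 by [].
  rewrite OE => p Sp x _; apply/eqP; apply: contrapT => /negP px.
  by apply: noS; exists p => //; apply: contraNneq px => ->; rewrite meval0.
have [x x0 pqx] := exists_nonzero_value ch0 (mulf_neq0 p0 q0).
have xE : (fun i => (\col_i x i) i ord0) = x by apply/funext => i; rewrite mxE.
move: pqx; rewrite mevalM mulf_eq0 negb_or => /andP[px qx].
exists (line_of (col_of_neq0 x0)); split; last first.
  by exists (\col_i x i); rewrite ?xE // memv_line.
apply: contrapT => nO.
have : (~` O)%classic (line_of (col_of_neq0 x0)) by [].
rewrite OE => /(_ p Sp (\col_i x i)); rewrite memv_line xE => /(_ isT)/eqP.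
by rewrite (negPf px).
Qed.

Definition nonvanishing_prod {K : fieldType} {m n : nat}
    (q : {mpoly K[m + n]}) : set (proj K m * proj K n) :=
  [set LM : proj K m * proj K n | exists (x : 'cV_m) (y : 'cV_n),
    [/\ x \in val LM.1, y \in val LM.2 & q.@[fun i => col_mx x y i ord0] != 0]]%classic.

Lemma nonvanishing_prod_open_dense (K : fieldType) m n d e
    (q : {mpoly K[m.+1 + n.+1]}) :
  [pchar K]%R =i pred0 -> bihomog d e q -> q != 0 ->
  open_dense (@zariski_closed_prod K m.+1 n.+1) (nonvanishing_prod q).
Proof.
move=> ch0 hq q0; split.
  exists [set q]%classic; first by move=> _ ->; exists d, e.
  apply/predeqP => LM; split=> [nL _ -> x y xL yM|qL [x [y [xL yM /eqP]]]].
    by apply/eqP; apply: contrapT => /negP qx; apply: nL; exists x, y.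
  by apply; apply: qL.
move=> O [S hS OE] [L0 OL0].
have [p Sp p0] : exists2 p, S p & p != 0.
  apply: contrapT => noS; suff : (~` O)%classic L0 by [].
  rewrite OE => p Sp x y _ _; apply/eqP; apply: contrapT => /negP px.
  by apply: noS; exists p => //; apply: contraNneq px => ->; rewrite meval0.
have [z z0 pqz] := exists_nonzero_value ch0 (mulf_neq0 p0 q0).
pose x i := z (lshift n.+1 i); pose y j := z (rshift m.+1 j).
have zE : (fun i => col_mx (\col_i x i) (\col_j y j) i ord0) = z.
  by apply/funext => i; rewrite mxE; case: split_ordP => j ->; rewrite mxE.
move: pqz; rewrite mevalM mulf_eq0 negb_or => /andP[pz qz].
have x0 : \col_i x i != 0 by apply: col_of_neq0 => i; apply: z0.
have y0 : \col_j y j != 0 by apply: col_of_neq0 => i; apply: z0.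
exists (line_of x0, line_of y0); split; last first.
  by exists (\col_i x i), (\col_j y j); rewrite zE !memv_line.
apply: contrapT => nO.
have : (~` O)%classic (line_of x0, line_of y0) by [].
rewrite OE => /(_ p Sp (\col_i x i) (\col_j y j)).
by rewrite !memv_line zE => /(_ isT isT)/eqP; rewrite (negPf pz).
Qed.

Lemma line_of_gen (K : fieldType) n (L : proj K n) (x : 'cV[K]_n)
    (x0 : x != 0) :
  x \in val L -> L = line_of x0.
Proof.
move=> xL; apply: val_inj; apply/eqP; rewrite /= eq_sym eqEdim -memvE xL /=.
by rewrite (eqP (svalP L)) dim_vline x0.
Qed.

Lemma line_of_inj (K : fieldType) n (x y : 'cV[K]_n) i (x0 : x != 0)
    (y0 : y != 0) :
  x i 0 = 1 -> y i 0 = 1 -> line_of x0 = line_of y0 -> x = y.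
Proof.
move=> xi yi /(congr1 val) /= xy.
have := memv_line x; rewrite xy => /vlineP[c xE].
by move: xi; rewrite xE mxE yi mulr1 => ->; rewrite scale1r.
Qed.

(** A line of the affine chart of the coordinate i contains a single vector whose
coordinate i is 1, so a parameter of such vectors is a parameter of lines. *)
Lemma chart_card (K : fieldType) n (T : Type) (P : set T) (Q : 'cV[K]_n -> Prop)
    (chart : T -> 'cV[K]_n) (i : 'I_n) :
  (forall t, chart t i 0 = 1) -> injective chart ->
  (forall t, P t -> Q (chart t)) ->
  (forall x, Q x -> exists t c, [/\ P t, c != 0 & x = c *: chart t]) ->
  (P #= [set L : proj K n | exists2 x : 'cV_n, x \in val L & Q x])%card.
Proof.
move=> ch1 ch_inj PQ QP.
have ch0 t : chart t != 0.
  by apply/eqP => /colP/(_ i); rewrite ch1 mxE => /eqP; rewrite oner_eq0.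
suff -> : [set L : proj K n | exists2 x : 'cV_n, x \in val L & Q x]%classic
    = ((fun t => line_of (ch0 t)) @` P)%classic.
  rewrite card_eq_sym; apply: inj_card_eq => s t _ _.
  by move/(line_of_inj (ch1 s) (ch1 t))/ch_inj.
apply/predeqP => L; split=> [[x xL Qx]|[t Pt <-]].
  have [t [c [Pt c0 xE]]] := QP x Qx; exists t => //.
  apply/esym/line_of_gen; rewrite -[chart t]scale1r -(mulVf c0) -scalerA.
  by apply: memvZ; rewrite -xE.
by exists (chart t); [apply: memv_line|apply: PQ].
Qed.

Lemma mpolyX_neq0 (K : fieldType) n (i : 'I_n) : 'X_i != 0 :> {mpoly K[n]}.
Proof.
apply/eqP => /(congr1 (meval (fun=> 1))).
by rewrite mevalXU meval0 => /eqP; rewrite oner_eq0.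
Qed.

Lemma mpolyXB_neq0 (K : fieldType) n (i j : 'I_n) :
  i != j -> 'X_i - 'X_j != 0 :> {mpoly K[n]}.
Proof.
move=> ij; apply/eqP => /(congr1 (meval (fun k => (k == i)%:R))).
rewrite mevalB !mevalXU meval0 eqxx eq_sym (negPf ij) subr0 => /eqP.
by rewrite oner_eq0.
Qed.

Lemma dhomogXU (K : fieldType) n (i : 'I_n) :
  ('X_i : {mpoly K[n]}) \is 1.-homog.
Proof. by rewrite dhomogX; apply/eqP; apply: mdeg1. Qed.

Lemma dhomogXB (K : fieldType) n (i j : 'I_n) :
  ('X_i - 'X_j : {mpoly K[n]}) \is 1.-homog.
Proof. by apply: rpredB; apply: dhomogXU. Qed.

(** The excluded points are 0:1, 1:0 and 1:1. *)
Lemma line_minus_three_points (K : fieldType) :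
  [pchar K]%R =i pred0 ->
  exists U : set (proj K 2), open_dense (@zariski_closed K 2) U /\
    ([set s : K | s != 0 /\ s != 1]%classic #= U)%card.
Proof.
move=> ch0; pose x0 : {mpoly K[2]} := 'X_(ord0).
pose x1 : {mpoly K[2]} := 'X_(ord_max).
pose q := x0 * x1 * (x0 - x1).
exists (nonvanishing q); split.
  apply: (@nonvanishing_open_dense _ _ (1 + 1 + 1)) => //.
    by do 2?[apply: dhomogM; try exact: dhomogXU]; apply: dhomogXB.
  by rewrite !mulf_neq0 ?mpolyX_neq0 ?mpolyXB_neq0.
pose chart (s : K) : 'cV[K]_2 := \col_i (if i == ord0 then s else 1).
have qE (x : 'cV[K]_2) : q.@[fun i => x i ord0]
    = x ord0 0 * x ord_max 0 * (x ord0 0 - x ord_max 0).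
  by rewrite !mevalM mevalB !mevalXU.
apply: (@chart_card _ _ _ _ _ chart ord_max).
- by move=> s; rewrite mxE.
- by move=> s t /colP/(_ ord0); rewrite !mxE.
- move=> s [s0 s1]; rewrite qE !mxE /= mulr1.
  by rewrite mulf_neq0 // subr_eq0.
move=> x; rewrite qE !mulf_eq0 !negb_or subr_eq0 -andbA => /and3P[a0 b0 ab].
exists (x ord0 0 / x ord_max 0), (x ord_max 0); split=> //.
  split; first by rewrite mulf_neq0 ?invr_eq0.
  by apply: contraNneq ab => /(canRL (divfK b0)) ->; rewrite mul1r.
apply/colP => i; rewrite !mxE; case: ifPn => [/eqP->|i0].
  by rewrite mulrC divfK.
by rewrite mulr1; congr (x _ _); apply: val_inj; case: i i0 => [[|[|]]].
Qed.

(** The single inequality is the dehomogenized form of the polynomials that cut out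
the open sets of parameters below. *)
Lemma admissible5 (K : fieldType) (s t : K) :
  admissible 5 (s, t) <->
  s * t * (s - 1) * (t - 1) * (s - t) != 0.
Proof.
rewrite /admissible /= !mulf_eq0 !negb_or !subr_eq0 -!andbA; split.
  by case=> /(_ isT)[-> ->] /(_ isT)[-> -> ->].
by case/and5P=> -> -> -> -> ->.
Qed.

(** In the chart where the last coordinate is 1, the inequalities on s and t
exclude five lines; the sixth one is the line at infinity. They are the lines
through two of the four points of a frame, the fifth point being s:t:1. *)
Lemma plane_minus_six_lines (K : fieldType) :
  [pchar K]%R =i pred0 ->
  exists U : set (proj K 3), open_dense (@zariski_closed K 3) U /\
    ([set p : K * K | admissible 5 p]%classic #= U)%card.
Proof.
move=> ch0; pose i1 : 'I_3 := inord 1.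
have i1E : val i1 = 1%N by rewrite /= inordK.
pose x0 : {mpoly K[3]} := 'X_(ord0); pose x1 : {mpoly K[3]} := 'X_i1.
pose x2 : {mpoly K[3]} := 'X_(ord_max).
pose q := x2 * (x0 * x1 * (x0 - x2) * (x1 - x2) * (x0 - x1)).
exists (nonvanishing q); split.
  apply: (@nonvanishing_open_dense _ _ (1 + (1 + 1 + 1 + 1 + 1))) => //.
    apply: dhomogM; first exact: dhomogXU.
    do 4?[apply: dhomogM; try exact: dhomogXU; try exact: dhomogXB];
      exact: dhomogXB.
  by rewrite !mulf_neq0 ?mpolyX_neq0 ?mpolyXB_neq0 // -val_eqE /= i1E.
pose chart (p : K * K) : 'cV[K]_3 :=
  \col_i (if i == ord0 then p.1 else if i == i1 then p.2 else 1).
have qE (x : 'cV[K]_3) (a := x ord0 0) (b := x i1 0) (c := x ord_max 0) :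
    q.@[fun i => x i ord0] = c * (a * b * (a - c) * (b - c) * (a - b)).
  by rewrite !mevalM !mevalB !mevalXU.
have m1 : (ord_max == i1) = false by rewrite -val_eqE /= i1E.
apply: (@chart_card _ _ _ _ _ chart ord_max).
- by move=> p; rewrite mxE /= m1.
- move=> [s t] [s' t'] e; have := congr1 (fun y : 'cV_3 => y i1 0) e.
  have := congr1 (fun y : 'cV_3 => y ord0 0) e.
  by rewrite !mxE /= eqxx -[i1 == ord0]val_eqE /= i1E /= => -> ->.
- move=> [s t] /admissible5; rewrite qE !mxE /= eqxx m1 mul1r.
  by rewrite -[i1 == ord0]val_eqE /= i1E.
move=> x; rewrite qE mulf_eq0 negb_or => /andP[c0 h].
pose a := x ord0 0; pose b := x i1 0; pose c := x ord_max 0.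
exists (a / c, b / c), c; split=> //.
  apply/admissible5; apply: contraNneq h => e.
  have -> : x ord0 0 = a / c * c by rewrite divfK.
  have -> : x i1 0 = b / c * c by rewrite divfK.
  rewrite -/c; apply/eqP; move: e; move: (a / c) (b / c) => s t e.
  transitivity (s * t * (s - 1) * (t - 1) * (s - t) * c ^+ 5); first by ring.
  by rewrite e mul0r.
apply/colP => i; rewrite !mxE; case: ifPn => [/eqP->|i0].
  by rewrite /= mulrC divfK.
case: ifPn => [/eqP->|i1']; first by rewrite /= mulrC divfK.
rewrite mulr1; congr (x _ _); apply: val_inj.
by move: i0 i1'; rewrite -!val_eqE /= inordK //; case: i => [[|[|[|]]]].
Qed.

Lemma bihomogM (K : fieldType) m n d e d' e' (p q : {mpoly K[m + n]}) :
  bihomog d e p -> bihomog d' e' q -> bihomog (d + d') (e + e') (p * q).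
Proof.
move=> hp hq u /msuppM_le/allpairsP[[u1 u2] /= [/hp[d1 e1] /hq[d2 e2] ->]].
rewrite -d1 -d2 -e1 -e2 -!big_split /=.
by split; apply: eq_bigr => i _; rewrite mnmDE.
Qed.

Lemma bihomogB (K : fieldType) m n d e (p q : {mpoly K[m + n]}) :
  bihomog d e p -> bihomog d e q -> bihomog d e (p - q).
Proof.
move=> hp hq u; rewrite -[_ \in _]negbK -mcoeff_eq0 mcoeffB => pq.
have [/hp //|up] := boolP (u \in msupp p).
have [/hq //|uq] := boolP (u \in msupp q).
by move: pq; rewrite !memN_msupp_eq0 // subrr eqxx.
Qed.

Lemma bihomogXl (K : fieldType) m n (i : 'I_m) :
  bihomog 1 0 ('X_(lshift n i) : {mpoly K[m + n]}).
Proof.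
move=> u; rewrite msuppX inE => /eqP->; split.
  rewrite (bigD1 i) //= mnm1E eqxx big1 ?addn0 // => j ji.
  by rewrite mnm1E eq_lshift eq_sym (negPf ji).
by rewrite big1 // => j _; rewrite mnm1E eq_lrshift.
Qed.

Lemma bihomogXr (K : fieldType) m n (j : 'I_n) :
  bihomog 0 1 ('X_(rshift m j) : {mpoly K[m + n]}).
Proof.
move=> u; rewrite msuppX inE => /eqP->; split.
  by rewrite big1 // => i _; rewrite mnm1E eq_rlshift.
rewrite (bigD1 j) //= mnm1E eqxx big1 ?addn0 // => i ij.
by rewrite mnm1E eq_rshift eq_sym (negPf ij).
Qed.

(** The excluded curves are the diagonal and, for each factor, the fibres over 0, 1
and infinity. *)
Lemma line_square_minus_curves (K : fieldType) :
  [pchar K]%R =i pred0 ->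
  exists U : set (proj K 2 * proj K 2),
    open_dense (@zariski_closed_prod K 2 2) U /\
    ([set p : K * K | admissible 5 p]%classic #= U)%card.
Proof.
move=> ch0.
pose x0 : {mpoly K[2 + 2]} := 'X_(lshift 2 ord0).
pose x1 : {mpoly K[2 + 2]} := 'X_(lshift 2 ord_max).
pose y0 : {mpoly K[2 + 2]} := 'X_(rshift 2 ord0).
pose y1 : {mpoly K[2 + 2]} := 'X_(rshift 2 ord_max).
(* The first two factors exclude the points at infinity. *)
pose q := x1 * y1 * (x0 * y0 * (x0 - x1) * (y0 - y1) * (x0 * y1 - x1 * y0)).
have hx0 : bihomog 1 0 x0 by apply: bihomogXl.
have hx1 : bihomog 1 0 x1 by apply: bihomogXl.
have hy0 : bihomog 0 1 y0 by apply: bihomogXr.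
have hy1 : bihomog 0 1 y1 by apply: bihomogXr.
exists (nonvanishing_prod q); split.
  apply: (@nonvanishing_prod_open_dense _ _ _ 4 4) => //.
    apply: (@bihomogM _ _ _ 1 1 3 3); first exact: (@bihomogM _ _ _ 1 0 0 1).
    apply: (@bihomogM _ _ _ 2 2 1 1); last first.
      apply: bihomogB; first exact: (@bihomogM _ _ _ 1 0 0 1).
      exact: (@bihomogM _ _ _ 1 0 0 1).
    apply: (@bihomogM _ _ _ 2 1 0 1); last exact: bihomogB.
    apply: (@bihomogM _ _ _ 1 1 1 0); last exact: bihomogB.
    exact: (@bihomogM _ _ _ 1 0 0 1).
  rewrite !mulf_neq0 ?mpolyX_neq0 ?mpolyXB_neq0 //.
  apply/eqP => /(congr1 (meval (fun k =>
    ((k == lshift 2 ord0) || (k == rshift 2 ord_max))%:R))).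
  rewrite mevalB !mevalM !mevalXU meval0 /= !mulr1 !mulr0 subr0 => /eqP.
  by rewrite oner_eq0.
have qE (x y : 'cV[K]_2) (a := x ord0 0) (b := x ord_max 0)
    (c := y ord0 0) (d := y ord_max 0) : q.@[fun i => col_mx x y i ord0]
    = b * d * (a * c * (a - b) * (c - d) * (a * d - b * c)).
  by rewrite !(mevalM, mevalB) !mevalXU !col_mxEu !col_mxEd.
pose chart (s : K) : 'cV[K]_2 := \col_i (if i == ord0 then s else 1).
have ch1 s : chart s ord_max 0 = 1 by rewrite mxE.
have ch_n0 s : chart s != 0.
  by apply/eqP => /colP/(_ ord_max); rewrite ch1 mxE => /eqP; rewrite oner_eq0.
have chartE (x : 'cV[K]_2) : x ord_max 0 != 0 ->
    x = x ord_max 0 *: chart (x ord0 0 / x ord_max 0).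
  move=> b0; apply/colP => i; rewrite !mxE; case: ifPn => [/eqP->|i0].
    by rewrite mulrC divfK.
  by rewrite mulr1; congr (x _ _); apply: val_inj; case: i i0 => [[|[|]]].
suff -> : nonvanishing_prod q = ((fun p : K * K =>
    (line_of (ch_n0 p.1), line_of (ch_n0 p.2)))
    @` [set p | admissible 5 p])%classic.
  rewrite card_eq_sym; apply: inj_card_eq => -[s t] [s' t'] _ _ E.
  have inj u w : chart u = chart w -> u = w by move/colP/(_ ord0); rewrite !mxE.
  congr (_, _); apply: inj.
    exact: line_of_inj (ch1 s) (ch1 s') (congr1 fst E).
  exact: line_of_inj (ch1 t) (ch1 t') (congr1 snd E).
apply/predeqP => -[L M]; split=> [[x [y [/= xL yM]]]|]; last first.
  case=> -[s t] adm [<- <-]; exists (chart s), (chart t).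
  split; rewrite ?memv_line // qE !mxE /= !(mul1r, mulr1).
  exact/admissible5.
rewrite qE => h; move: (h); rewrite mulf_eq0 negb_or => /andP[+ _].
rewrite mulf_eq0 negb_or => /andP[b0 d0].
have memch (z : 'cV[K]_2) (N : proj K 2) : z ord_max 0 != 0 -> z \in val N ->
    chart (z ord0 0 / z ord_max 0) \in val N.
  move=> z0 zN; rewrite -[chart _]scale1r -(mulVf z0) -scalerA; apply: memvZ.
  by rewrite -chartE.
exists (x ord0 0 / x ord_max 0, y ord0 0 / y ord_max 0) => /=; last first.
  by congr (_, _); apply/esym/line_of_gen; apply: memch.
apply/admissible5.
move: (divfK b0 (x ord0 0)) (divfK d0 (y ord0 0)) h.
move: (x ord0 0 / _) (y ord0 0 / _) => s t <- <-.
move: (x ord_max 0) (y ord_max 0) => b d; apply: contraNneq => e.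
suff -> : b * d * (s * b * (t * d) * (s * b - b) * (t * d - d)
    * (s * b * d - b * (t * d)))
  = s * t * (s - 1) * (t - 1) * (s - t) * (b ^+ 4 * d ^+ 4) by rewrite e mul0r.
by ring.
Qed.

End Zariski.

(** * Ranks two and three *)

Section Fibres.

Local Open Scope set_scope.
Local Open Scope ring_scope.

(** At least two classes are needed to have rank 2, and five rows form at most
five classes. *)
Lemma exists_labels_rank2 (K : fieldType) (M : 'M[K]_(5, 2)) :
  \rank M = 2%N ->
  exists lab k, [/\ pattern M lab, complete_labels lab k & (2 <= k <= 5)%N].
Proof.
move=> rM; have [lab [k [p ck]]] := exists_labels M; exists lab, k; split=> //.
have [k5 _ _] := complete_labels_seq ck; rewrite k5 andbT leqNgt.
apply/negP => k1.
suff : (\rank M <= 1)%N by rewrite rM.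
apply: rdet0_rank1 => i j; apply/eqP; rewrite p.2.
have := ck.1 i; have := ck.1 j; lia.
Qed.

Lemma rank_map_le_setT (K : fieldType) (v : conf K) J :
  (rank_map v J <= rank_map v [set: 'I_5])%N.
Proof.
have [A Av] := exists_spans v.
by rewrite (rank_map_setT Av) (rank_map_spans _ Av) mxrankM_maxr.
Qed.

Lemma rank_map_setT_bounds (K : fieldType) (v : conf K) :
  (0 < rank_map v [set: 'I_5] <= 4)%N.
Proof.
have [A Av] := exists_spans v; rewrite {2}(rank_map_setT Av) rank_leq_col andbT.
by apply: leq_trans (rank_map_le_setT v [set ord0]); rewrite rank_map1.
Qed.

Lemma rank_map_types (K : fieldType) (v : conf K) s :
  all (leq 1) s -> has_type (rank_map v) s ->
  rank_map v [set: 'I_5] = (size s).+1.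
Proof.
apply: has_type_rank; first exact: rank_map_le_setT.
by have /andP[] := rank_map_setT_bounds v.
Qed.

(** Here k is the number of distinct points of a configuration on a line. *)
Lemma fibre_rank2 (K : fieldType) (v : conf K) (phi := rank_map v) :
  phi [set: 'I_5] = 2%N ->
  exists k, [/\ nb_faces phi 1 = k,
    (k <= 3)%N \/ k = 4 \/ k = 5,
    (k <= 3)%N -> fibre phi = GL_orbit v,
    k = 4 -> (@fibre_orbits K phi #= [set s : K | s != 0 /\ s != 1])%card
  & k = 5 -> (@fibre_orbits K phi #= [set p : K * K | admissible 5 p])%card].
Proof.
move=> r2; have enc := primal_encoding v; move: enc; rewrite /= -/phi r2 => enc.
have fv : fibre phi v by [].
have [M Mv] : exists M : 'M[K]_(5, 2), primal_code M v.
  by case: enc => + _ _ _; apply.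
have [lab [k [p ck k25]]] := exists_labels_rank2 Mv.1.
have [C1 C2 C3] := fibre_two_rows enc fv Mv p ck k25.
exists k; split=> //; last by lia.
apply: nb_faces_rank2 ck _ _ _; first by case/andP: k25.
  by move=> J; rewrite /phi (primal_code_rank _ Mv) (rank_pattern _ p).
exact: rank_map1.
Qed.

(** Here k counts the classes of parallel nonzero rows in a base of the relations
between the five vectors. *)
Lemma fibre_rank3 (K : fieldType) (v : conf K) (phi := rank_map v) :
  phi [set: 'I_5] = 3%N ->
  let a := (nb_faces phi 1, nb_faces phi 2) in
  exists k, [/\
    ((a \in [:: (5, 5); (5, 8)]) = (k == 4)) /\ ((a == (5, 10)) = (k == 5)),
    (k <= 3)%N \/ k = 4 \/ k = 5,
    (k <= 3)%N -> fibre phi = GL_orbit v,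
    k = 4 -> (@fibre_orbits K phi #= [set s : K | s != 0 /\ s != 1])%card
  & k = 5 -> (@fibre_orbits K phi #= [set p : K * K | admissible 5 p])%card].
Proof.
move=> r3; have enc := dual_encoding v; move: enc; rewrite /= -/phi r3 => enc.
have fv : fibre phi v by [].
have [M Mv] : exists M : 'M[K]_(5, 2), dual_code M v.
  by case: enc => + _ _ _; apply.
have [lab [k [p ck k25]]] := exists_labels_rank2 Mv.1.
have [C1 C2 C3] := fibre_two_rows enc fv Mv p ck k25.
exists k; split=> //; last by lia.
apply: nb_faces_rank3 ck _ _ _; first by case/andP: k25.
  by move=> J; rewrite /phi (dual_code_rank _ Mv) (rank_pattern _ p).
exact: rank_map1.
Qed.

End Fibres.

Theorem theorem1p3 (K : closedFieldType) (charK0 : [pchar K]%R =i pred0)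
    (phi : {ffun {set 'I_5} -> nat})
    (phi_im : exists v : conf K, rank_map v = phi) :
  (~ (has_type phi [:: 4] \/ has_type phi [:: 5] \/ has_type phi [:: 5; 5] \/
      has_type phi [:: 5; 8] \/ has_type phi [:: 5; 10]) ->
     exists v : conf K, fibre phi = GL_orbit v) /\
  (has_type phi [:: 4] ->
     exists U : set (proj K 2),
       open_dense (@zariski_closed K 2) U /\
       (@fibre_orbits K phi #= U)%card) /\
  (has_type phi [:: 5] ->
     exists U : set (proj K 2 * proj K 2),
       open_dense (@zariski_closed_prod K 2 2) U /\
       (@fibre_orbits K phi #= U)%card) /\
  (has_type phi [:: 5; 5] ->
     exists U : set (proj K 2),
       open_dense (@zariski_closed K 2) U /\
       (@fibre_orbits K phi #= U)%card) /\
  (has_type phi [:: 5; 8] ->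
     exists U : set (proj K 2),
       open_dense (@zariski_closed K 2) U /\
       (@fibre_orbits K phi #= U)%card) /\
  (has_type phi [:: 5; 10] ->
     exists U : set (proj K 3),
       open_dense (@zariski_closed K 3) U /\
       (@fibre_orbits K phi #= U)%card).
Proof.
case: phi_im => v <-; set ph := rank_map v.
have [U1 [oU1 cU1]] := line_minus_three_points charK0.
have [U2 [oU2 cU2]] := plane_minus_six_lines charK0.
have [U11 [oU11 cU11]] := line_square_minus_curves charK0.
have type_rank s :
    all (leq 1) s -> has_type ph s -> ph [set: 'I_5] = (size s).+1.
  exact: rank_map_types.
have type_top := @has_type_top ph _ (rank_map_le_setT v).
split; last split; last split; last split; last split.
- move=> ntype; exists v.
  have := rank_map_setT_bounds v; rewrite -/ph.
  case r : (ph _) => [|[|[|[|[|r']]]]] // _.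
  + have := primal_encoding v; rewrite /= -/ph r => enc.
    exact: fibre_one_row enc _.
  + have [k [nk [k3|[k4|k5]] C _ _]] := fibre_rank2 r; first exact: C.
      case: ntype; left; apply: type_top => // -[] // _.
      by rewrite nk k4.
    case: ntype; right; left; apply: type_top => // -[] // _.
    by rewrite nk k5.
  + have [k [[n4 n5] [k3|[k4|k5]] C _ _]] := fibre_rank3 r; first exact: C.
      move: n4; rewrite k4 eqxx !inE => /orP[]/eqP[n1 n2]; case: ntype.
        by right; right; left; apply: type_top => // -[|[]] //.
      by right; right; right; left; apply: type_top => // -[|[]] //.
    move: n5; rewrite k5 eqxx => /eqP[n1 n2]; case: ntype.
    by right; right; right; right; apply: type_top => // -[|[]] //.
  + have := dual_encoding v; rewrite /= -/ph r => enc.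
    exact: fibre_one_row enc _.
- move=> t4; have [k [nk _ _ C _]] := fibre_rank2 (type_rank [:: 4] isT t4).
  exists U1; split=> //; apply: card_eq_trans cU1; apply: C.
  by rewrite -nk; apply: (t4 0%N).
- move=> t5; have [k [nk _ _ _ C]] := fibre_rank2 (type_rank [:: 5] isT t5).
  exists U11; split=> //; apply: card_eq_trans cU11; apply: C.
  by rewrite -nk; apply: (t5 0%N).
- move=> t; have [k [[n4 _] _ _ C _]] := fibre_rank3 (type_rank [:: 5; 5] isT t).
  exists U1; split=> //; apply: card_eq_trans cU1; apply: C; apply/eqP.
  by rewrite -n4 (t 0%N) (t 1%N).
- move=> t; have [k [[n4 _] _ _ C _]] := fibre_rank3 (type_rank [:: 5; 8] isT t).
  exists U1; split=> //; apply: card_eq_trans cU1; apply: C; apply/eqP.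
  by rewrite -n4 (t 0%N) (t 1%N).
- move=> t; have [k [[_ n5] _ _ _ C]] := fibre_rank3 (type_rank [:: 5; 10] isT t).
  exists U2; split=> //; apply: card_eq_trans cU2; apply: C; apply/eqP.
  by rewrite -n5 (t 0%N) (t 1%N).
Qed.
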